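(* Under each of the asymptotic frameworks (F1), (F2), (F3), and independently of the chosen value $\Upsilon\in\mathbb N$, the following holds. (a) $B_1(\Upsilon)$ is an unbiased, dimensionally stable and ratio-consistent estimator for $\operatorname{tr}(TV_N)$. (b) $B_2(\Upsilon)$ is an unbiased, dimensionally stable and ratio-consistent estimator for $\operatorname{tr}\big((TV_N)^2\big)$. (c) $B_3(\Upsilon)$ is an unbiased estimator for $\operatorname{tr}\big((TV_N)^3\big)$, which additionally fulfils $\operatorname{Var}(B_3(\Upsilon))\le \mathcal O(n_{\min}^{-1})\cdot\mathcal O\big(\operatorname{tr}^3\big((TV_N)^2\big)\big)$.
   Context: Model: there are $a$ groups; in group $i\in\{1,\dots,a\}$ one observes independent random vectors $X_{i,j}\sim\mathcal N_{d_i}(\mu_i,\Sigma_i)$, $j=1,\dots,n_i$, with $\mu_i\in\mathbb R^{d_i}$ and $\Sigma_i\in\mathbb R^{d_i\times d_i}$ positive definite; all $X_{i,j}$ are independent. The dimensions $d_i$ may differ between groups. Put $N=\sum_{i=1}^a n_i$, $n_{\min}=\min(n_1,\dots,n_a)$, $D=\sum_{i=1}^a d_i$, and $V_N=\bigoplus_{i=1}^a \frac{N}{n_i}\Sigma_i$ (block diagonal). $T\in\mathbb R^{D\times D}$ is a nonzero symmetric idempotent matrix. The quantities $a, d_i, n_i,\mu_i,\Sigma_i,T$ may all depend on $N$ (subject to the framework), and limits are along $N\to\infty$. No null hypothesis on the means is assumed. $\operatorname{tr}^k(M)=(\operatorname{tr}M)^k$. Asymptotic frameworks: (F1) $a$ is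 fixed and $\min(\max(d_1,\dots,d_a),n_1,\dots,n_a)\to\infty$; (F2) all $d_i$ are fixed and $\min(a,n_1,\dots,n_a)\to\infty$; (F3) $\min(a,\max(d_1,\dots,d_a),n_1,\dots,n_a)\to\infty$. Sample sizes are taken large enough that all expressions are defined. For $j\in\mathbb N$ and $i=1,\dots,a$ let $\pi_{j,i}$ be a uniformly random permutation of $1,\dots,n_i$, with $\pi_{j,i}(l)$ its $l$-th component, independent for different $(j,i)$ and independent of the data. For $\ell_1\ne\ell_2\in\{1,\dots,n_{\min}\}$ put $$Z^{\pi_j}_{(\ell_1,\ell_2)}=\Big(\sqrt{\tfrac N{n_1}}(X_{1,\pi_{j,1}(\ell_1)}-X_{1,\pi_{j,1}(\ell_2)})^\top,\dots,\sqrt{\tfrac N{n_a}}(X_{a,\pi_{j,a}(\ell_1)}-X_{a,\pi_{j,a}(\ell_2)})^\top\Big)^\top .$$ Then $$B_1(\Upsilon)=\frac1{2\Upsilon}\sum_{j=1}^{\Upsilon}\sum_{1\le\ell_1<\ell_2\le n_{\min}}\frac{(Z^{\pi_j}_{(\ell_1,\ell_2)})^\top TZ^{\pi_j}_{(\ell_1,\ell_2)}}{\binom{n_{\min}}2},\qquad B_2(\Upsilon)=\frac1{4\Upsilon}\sum_{j=1}^{\Upsilon}\sum\frac{\big[(Z^{\pi_j}_{(\ell_1,\ell_2)})^\top TZ^{\pi_j}_{(\ell_3,\ell_4)}\big]^2}{6\binom{n_{\min}}4},$$ the inner sum in $B_2$ being over pairwise distinct $\ell_1,\dots,\ell_4\in\{1,\dots,n_{\min}\}$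 with $\ell_1<\ell_2$, $\ell_3<\ell_4$, and $$B_3(\Upsilon)=\frac1{8\Upsilon}\sum_{j=1}^{\Upsilon}\sum\frac{(Z^{\pi_j}_{(\ell_1,\ell_2)})^\top TZ^{\pi_j}_{(\ell_3,\ell_4)}\,(Z^{\pi_j}_{(\ell_3,\ell_4)})^\top TZ^{\pi_j}_{(\ell_5,\ell_6)}\,(Z^{\pi_j}_{(\ell_5,\ell_6)})^\top TZ^{\pi_j}_{(\ell_1,\ell_2)}}{n_{\min}!/(n_{\min}-6)!},$$ the inner sum being over pairwise distinct $\ell_1,\dots,\ell_6\in\{1,\dots,n_{\min}\}$. An estimator $\hat\theta_N$ of $\theta_N>0$ is ratio-consistent if $\hat\theta_N/\theta_N\to1$ in probability. It is dimensionally stable if $|\mathbb E(\hat\theta_N/\theta_N)-1|$ and $\operatorname{Var}(\hat\theta_N/\theta_N)$ are bounded by a null sequence depending only on $a$ and the sample sizes $n_1,\dots,n_a$ (not on the dimensions $d_i$, on $\Sigma_i$, or on $T$). The bound in (c) means that $\operatorname{Var}(B_3(\Upsilon))\le C\,n_{\min}^{-1}\operatorname{tr}^3((TV_N)^2)$ for a constant $C$ and all sufficiently large $N$. *)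

(* Defs.v *)
From HB Require Import structures.
From mathcomp Require Import all_boot all_order all_fingroup all_algebra.
From mathcomp Require Import all_classical all_reals all_analysis.

Set Implicit Arguments.
Unset Strict Implicit.
Unset Printing Implicit Defensive.

Import Order.TTheory GRing.Theory Num.Theory.
Import numFieldNormedType.Exports.

Local Open Scope classical_set_scope.
Local Open Scope ring_scope.

Definition bilin (R : realType) (p : nat) (u : 'cV[R]_p) (A : 'M[R]_p)
  (v : 'cV[R]_p) : R := (u^T *m A *m v) 0 0.

Definition posdef (R : realType) (p : nat) (S : 'M[R]_p) : Prop :=
  S^T = S /\ forall u : 'cV[R]_p, u != 0 -> 0 < bilin u S u.

Definition vec_coord (R : realType) (T : Type) (p : nat) (X : T -> 'cV[R]_p)
  (c : 'I_p) (w : T) : R := X w c 0.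

Definition sigma_vec (R : realType) (T : Type) (p : nat)
  (X : T -> 'cV[R]_p) : set (set T) := g_sigma_preimage (vec_coord X).

(* The sigma-algebra generated by a map into a finite discrete space. *)
Definition sigma_fin (T : Type) (I : finType) (f : T -> I) : set (set T) :=
  preimage_set_system setT f setT.

(* X ~ N(mu, S) for positive definite S: every nontrivial linear form u^T X is
   N(u^T mu, u^T S u). The second parameter of [normal_prob] is the standard
   deviation, which is nonzero here; at 0 [normal_prob] is not a Dirac mass. *)
Definition normal_vec (R : realType) (d : measure_display)
  (T : measurableType d) (P : probability T R) (p : nat)
  (X : T -> 'cV[R]_p) (mu : 'cV[R]_p) (S : 'M[R]_p) : Prop :=
  (forall c, measurable_fun setT (vec_coord X c)) /\
  forall u : 'cV[R]_p, u != 0 -> forall A : set R, measurable A ->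
    P [set w | A ((u^T *m X w) 0 0)] =
    normal_prob ((u^T *m mu) 0 0) (Num.sqrt (bilin u S u)) A.

Definition mutually_independent (R : realType) (d : measure_display)
  (T : measurableType d) (P : probability T R) (I : choiceType)
  (F : I -> set (set T)) : Prop :=
  forall (s : seq I) (E : I -> set T), uniq s ->
    (forall i, i \in s -> F i (E i)) ->
    P (\bigcap_(i in [set` s]) E i) = (\prod_(i <- s) P (E i))%E.

Definition independent2 (R : realType) (d : measure_display)
  (T : measurableType d) (P : probability T R) (F G : set (set T)) : Prop :=
  forall A B, F A -> G B -> P (A `&` B) = (P A * P B)%E.

(* One instance of the multi-group model, for one value of the asymptotic
   index. Groups, observations and permutations are numbered from 0. *)
Record model (R : realType) := Model {
  disp : measure_display;
  Omega : measurableType disp;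
  prob : probability Omega R;
  ngroups : nat;
  dim : 'I_ngroups -> nat;
  nobs : 'I_ngroups -> nat;
  mean : forall i : 'I_ngroups, 'cV[R]_(dim i);
  cov : forall i : 'I_ngroups, 'M[R]_(dim i);
  projT : 'M[R]_(\sum_(i < ngroups) dim i);
  obs : forall i : 'I_ngroups, 'I_(nobs i) -> Omega -> 'cV[R]_(dim i);
  shuffle : nat -> forall i : 'I_ngroups, Omega -> {perm 'I_(nobs i)};
  ngroups_gt0 : (0 < ngroups)%N;
  dim_gt0 : forall i, (0 < dim i)%N;
  nobs_gt0 : forall i, (0 < nobs i)%N;
  cov_posdef : forall i, posdef (cov i);
  projT_neq0 : projT != 0;
  projT_sym : projT^T = projT;
  projT_idem : projT *m projT = projT;
  obs_normal : forall i (j : 'I_(nobs i)),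
    normal_vec prob (obs j) (mean i) (cov i);
  obs_indep : mutually_independent prob
    (fun ij : {i : 'I_ngroups & 'I_(nobs i)} => sigma_vec (obs (tagged ij)));
  shuffle_meas : forall j i (s : {perm 'I_(nobs i)}),
    measurable (shuffle j i @^-1` [set s]);
  shuffle_unif : forall j i (s : {perm 'I_(nobs i)}),
    prob (shuffle j i @^-1` [set s]) = (((nobs i)`!%:R)^-1)%:E;
  shuffle_indep : mutually_independent prob
    (fun ji : nat * 'I_ngroups => sigma_fin (shuffle ji.1 ji.2));
  shuffle_obs_indep : independent2 prob
    <<s \bigcup_(ji in [set: nat * 'I_ngroups])
          sigma_fin (shuffle ji.1 ji.2) >>
    <<s \bigcup_(ij in [set: {i : 'I_ngroups & 'I_(nobs i)}])
          sigma_vec (obs (tagged ij)) >>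
}.

Section quantities.
Variables (R : realType) (m : model R).

Definition ntot : nat := (\sum_(i < ngroups m) nobs i)%N.

(* [ntot] is only the neutral start value: it bounds every [nobs i]. *)
Definition nmin : nat := \big[minn/ntot]_(i < ngroups m) nobs i.

Definition dmax : nat := \max_(i < ngroups m) dim i.

Lemma nmin_le (i : 'I_(ngroups m)) : (nmin <= nobs i)%N.
Proof. by rewrite /nmin -minEnat -leEnat; exact: bigmin_le_cond. Qed.

Definition VN : 'M[R]_(\sum_(i < ngroups m) dim i) :=
  \mxdiag_(i < ngroups m) ((ntot%:R / (nobs i)%:R) *: cov i).

Definition TV : 'M[R]_(\sum_(i < ngroups m) dim i) := projT m *m VN.

Definition shuffled (j : nat) (i : 'I_(ngroups m)) (l : 'I_nmin)
  (w : Omega m) : 'cV[R]_(dim i) :=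
  obs (shuffle j i w (widen_ord (nmin_le i) l)) w.

Definition Zdiff (j : nat) (l1 l2 : 'I_nmin) (w : Omega m) :
  'cV[R]_(\sum_(i < ngroups m) dim i) :=
  \mxcol_(i < ngroups m)
    (Num.sqrt (ntot%:R / (nobs i)%:R) *:
       (shuffled j i l1 w - shuffled j i l2 w)).

Definition ZTZ (j : nat) (l1 l2 l3 l4 : 'I_nmin) (w : Omega m) : R :=
  bilin (Zdiff j l1 l2 w) (projT m) (Zdiff j l3 l4 w).

Definition B1 (U : nat) (w : Omega m) : R :=
  (2 * U%:R)^-1 * \sum_(j < U)
    \sum_(l1 < nmin) \sum_(l2 < nmin | (l1 < l2)%N)
      ZTZ j l1 l2 l1 l2 w / 'C(nmin, 2)%:R.

Definition B2 (U : nat) (w : Omega m) : R :=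
  (4 * U%:R)^-1 * \sum_(j < U)
    \sum_(l1 < nmin) \sum_(l2 < nmin) \sum_(l3 < nmin)
    \sum_(l4 < nmin | [&& uniq [:: l1; l2; l3; l4],
                          (l1 < l2)%N & (l3 < l4)%N])
      ZTZ j l1 l2 l3 l4 w ^+ 2 / (6 * 'C(nmin, 4))%:R.

Definition B3 (U : nat) (w : Omega m) : R :=
  (8 * U%:R)^-1 * \sum_(j < U)
    \sum_(l1 < nmin) \sum_(l2 < nmin) \sum_(l3 < nmin)
    \sum_(l4 < nmin) \sum_(l5 < nmin)
    \sum_(l6 < nmin | uniq [:: l1; l2; l3; l4; l5; l6])
      (ZTZ j l1 l2 l3 l4 w * ZTZ j l3 l4 l5 l6 w * ZTZ j l5 l6 l1 l2 w)
      / (nmin`!%:R / (nmin - 6)`!%:R).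

End quantities.

Variant framework := fixed_groups | fixed_dims | all_growing.

(* Every ingredient, including the probability space, may vary with the index
   k; the total sample size [ntot (m k)] tends to infinity in each case. *)
Definition in_framework (R : realType) (F : framework) (m : nat -> model R) :
  Prop :=
  match F with
  | fixed_groups =>
      (exists a : nat, forall k, ngroups (m k) = a) /\
      (minn (dmax (m k)) (nmin (m k)) @[k --> \oo] --> \oo)
  | fixed_dims =>
      (exists d : nat -> nat, forall k (i : 'I_(ngroups (m k))), dim i = d i) /\
      (minn (ngroups (m k)) (nmin (m k)) @[k --> \oo] --> \oo)
  | all_growing =>
      minn (ngroups (m k)) (minn (dmax (m k)) (nmin (m k)))
        @[k --> \oo] --> \oo
  end.

Definition estimator (R : realType) := forall m : model R, Omega m -> R.

(* In the two definitions below, [s] is the smallest value of [nmin] for which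
   the formula of the estimator makes sense. *)

Definition unbiased (R : realType) (F : framework) (s : nat)
  (est : estimator R) (theta : model R -> R) : Prop :=
  forall m : nat -> model R, in_framework F m ->
  forall k, (s <= nmin (m k))%N ->
    ('E_(prob (m k))[est (m k)] = (theta (m k))%:E)%E.

(* Dimensional stability, with explicit null sequence [b]. It is a function of
   the number of groups and the sample sizes only, chosen before the model. *)
Definition dim_stable (R : realType) (F : framework) (s : nat)
  (b : forall a : nat, ('I_a -> nat) -> R)
  (est : estimator R) (theta : model R -> R) : Prop :=
  forall m : nat -> model R, in_framework F m ->
    (b (ngroups (m k)) (@nobs R (m k)) @[k --> \oo] --> (0 : R)) /\
    forall k, (s <= nmin (m k))%N ->
      let ratio := fun w => est (m k) w / theta (m k) in
      let bk := b (ngroups (m k)) (@nobs R (m k)) in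
      (`| 'E_(prob (m k))[ratio] - 1 | <= bk%:E)%E /\
      ('V_(prob (m k))[ratio] <= bk%:E)%E.

Definition ratio_consistent (R : realType) (F : framework)
  (est : estimator R) (theta : model R -> R) : Prop :=
  forall m : nat -> model R, in_framework F m ->
    (forall k, 0 < theta (m k)) /\
    forall e : R, 0 < e ->
      prob (m k) [set w | e < `| est (m k) w / theta (m k) - 1 |]
        @[k --> \oo] --> 0%E.

(* Main.v *)
Require Import Defs.
From mathcomp Require Import all_boot all_order all_fingroup all_algebra.
From mathcomp Require Import all_classical all_reals all_analysis.
From mathcomp Require Import measurable_realfun zify ring lra.

(** Why the three estimators work.

    Freeze the permutations. In a difference of two observations of the same
    group the mean cancels, so the stacked difference Z at two distinct
    positions is a centred Gaussian vector with covariance S = 2 V_N, and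
    differences at disjoint pairs of positions are independent
    ([gvec_Zplan], [Zplan_indep]). Each estimator is then a U-statistic: after
    symmetrization it is the average of a kernel over all ordered k-tuples of
    distinct positions, with k = 2, 4, 6 ([B1E], [B2E], [B3E]).

    Unbiasedness is the computation of the kernel's mean by integrating out one
    vector at a time with E[(u.Z)(v.Z)] = u^T S v ([Ex_bilin_gvec],
    [Ex_cross2], [Ex_cycle3]); the factors 2, 4, 8 in the normalizations remove
    the powers of 2 that come from S = 2 V_N.

    For the variance, kernels at two tuples without a common position are
    uncorrelated, and for a given tuple only a fraction O(1/nmin) of the others
    shares a position with it. So the variance is O(1/nmin) times a bound for
    the second moment of the kernel ([ustat_var]), and the second moments have
    to be bounded by the right traces with absolute constants:
    - a positive semidefinite M is a sum of outer products b b^T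
      ([psd_sum_outer]), so Z^T M Z is a sum of squares of centred Gaussian
      variables. Expanding its square or cube and applying the inequality
      between arithmetic and geometric means to every term gives the bounds
      3 (tr MS)^2 and 15 (tr MS)^3 ([Ex_quad2], [Ex_quad3]);
    - for independent Z and Z', the form Z^T T Z' is, with Z' held fixed, a
      Gaussian variable with variance Z'^T (T S T) Z'. Its fourth and sixth
      moments thus reduce to the previous item with M = T S T
      ([Ex_cross4], [Ex_cross6]);
    - the square of the product of three forms in B_3 is at most a mean of
      their sixth powers ([Ex_kernel3_sq]).

    The permutations are independent of the data. So the actual estimator
    averages, over the possible values of the permutations, quantities that
    all obey the same bounds; averaging over the repetitions is then covered
    by the convexity of the square ([average_shuffled]). The variance bound is
    C theta^2 / nmin for an absolute C in the first two cases, so that dividing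
    by theta^2 leaves a null sequence in the sample sizes alone, and
    Chebyshev's inequality gives consistency.

    Two technical choices keep the probability elementary. All variables are
    taken from the algebra of functions with moments of all orders ([moments]),
    where integrability is preserved by every operation used. And a centred Gaussian variable is represented by its moment generating
    function ([gauss]): independent sums are immediate in this form, and the
    moments are recovered by differentiating at 0. *)

Set Implicit Arguments.
Unset Strict Implicit.
Unset Printing Implicit Defensive.

Import Order.TTheory GRing.Theory Num.Theory.
Import numFieldNormedType.Exports.

Local Open Scope classical_set_scope.
Local Open Scope ring_scope.

(** * Moments and expectations *)

Section moments.
Context (R : realType) (d : measure_display) (T : measurableType d)
  (P : probability T R).
Implicit Types f g : T -> R.

(** An algebra of functions on which the expectation is linear without side
    conditions; it contains the Gaussian variables and their exponentials. *)
Definition moments f := measurable_fun setT f /\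
  forall p : nat, P.-integrable setT (EFin \o (fun w => `|f w| ^+ p)).

Definition Ex f : R := \int[P]_w f w.

Lemma moments_meas f : moments f -> measurable_fun setT f.
Proof. by case. Qed.

Lemma moments_int f : moments f -> P.-integrable setT (EFin \o f).
Proof.
case=> mf /(_ 1%N) If.
apply: (le_integrable measurableT _ _ If); first exact/measurable_EFinP.
by move=> w _ /=; rewrite expr1 normr_id.
Qed.

Lemma moments_cst c : moments (fun=> c).
Proof.
split=> // p.
exact: (@finite_measure_integrable_cst _ _ _ P setT (`|c| ^+ p)).
Qed.

Lemma momentsD f g : moments f -> moments g -> moments (fun w => f w + g w).
Proof.
move=> [mf If] [mg Ig]; split; first exact: measurable_funD.
move=> p.
have I1 : P.-integrable setT
    (EFin \o (fun w => 2 ^+ p * (`|f w| ^+ p + `|g w| ^+ p))).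
  exact: (integrableZl measurableT (2 ^+ p)
            (integrableD measurableT (If p) (Ig p))).
apply: (le_integrable measurableT _ _ I1).
  apply/measurable_EFinP; apply: measurable_funX.
  by apply: measurableT_comp => //; exact: measurable_funD.
move=> w _ /=; rewrite lee_fin normrX normr_id [leRHS]ger0_norm; last first.
  by rewrite mulr_ge0 ?exprn_ge0 ?addr_ge0 ?exprn_ge0.
have [fg|/ltW gf] := leP `|f w| `|g w|.
  apply: (@le_trans _ _ ((2 * `|g w|) ^+ p)).
    by rewrite lerXn2r ?nnegrE ?mulr_ge0//; apply: le_trans (ler_normD _ _) _; lra.
  by rewrite exprMn ler_pM2l ?exprn_gt0// lerDr exprn_ge0.
apply: (@le_trans _ _ ((2 * `|f w|) ^+ p)).
  by rewrite lerXn2r ?nnegrE ?mulr_ge0//; apply: le_trans (ler_normD _ _) _; lra.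
by rewrite exprMn ler_pM2l ?exprn_gt0// lerDl exprn_ge0.
Qed.

Lemma momentsM f g : moments f -> moments g -> moments (fun w => f w * g w).
Proof.
move=> [mf If] [mg Ig]; split; first exact: measurable_funM.
move=> p.
have I1 : P.-integrable setT
    (EFin \o (fun w => `|f w| ^+ (2 * p) + `|g w| ^+ (2 * p))).
  exact: (integrableD measurableT (If _) (Ig _)).
apply: (le_integrable measurableT _ _ I1).
  apply/measurable_EFinP; apply: measurable_funX.
  by apply: measurableT_comp => //; exact: measurable_funM.
move=> w _ /=; rewrite lee_fin normrX normr_id [leRHS]ger0_norm; last first.
  by rewrite addr_ge0 ?exprn_ge0.
rewrite normrM exprMn mulnC !exprM.
have := sqr_ge0 (`|f w| ^+ p - `|g w| ^+ p).
have : 0 <= `|f w| ^+ p * `|g w| ^+ p by rewrite mulr_ge0 ?exprn_ge0.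
set a := `|f w| ^+ p; set b := `|g w| ^+ p => h1 h2.
nra.
Qed.

Lemma momentsZ c f : moments f -> moments (fun w => c * f w).
Proof. by move=> ?; apply: momentsM => //; exact: moments_cst. Qed.

Lemma momentsN f : moments f -> moments (fun w => - f w).
Proof.
move=> Mf; have := momentsZ (-1) Mf; congr moments.
by apply/funext => w; rewrite mulN1r.
Qed.

Lemma momentsB f g : moments f -> moments g -> moments (fun w => f w - g w).
Proof. by move=> ? ?; apply: momentsD => //; exact: momentsN. Qed.

Lemma momentsX f n : moments f -> moments (fun w => f w ^+ n).
Proof.
move=> Mf; elim: n => [|n IH].
  by under eq_fun do rewrite expr0; exact: moments_cst.
by under eq_fun do rewrite exprS; exact: momentsM.
Qed.

Lemma moments_sum (I : Type) (s : seq I) (Q : pred I) (F : I -> T -> R) :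
  (forall i, moments (F i)) -> moments (fun w => \sum_(i <- s | Q i) F i w).
Proof.
move=> MF; elim: s => [|i s IH].
  by under eq_fun do rewrite big_nil; exact: moments_cst.
under eq_fun do rewrite big_cons.
by case: (Q i) => //; exact: momentsD.
Qed.

Lemma moments_prod (I : Type) (s : seq I) (Q : pred I) (F : I -> T -> R) :
  (forall i, moments (F i)) -> moments (fun w => \prod_(i <- s | Q i) F i w).
Proof.
move=> MF; elim: s => [|i s IH].
  by under eq_fun do rewrite big_nil; exact: moments_cst.
under eq_fun do rewrite big_cons.
by case: (Q i) => //; exact: momentsM.
Qed.

Lemma Ex_EFin f : moments f -> ('E_P[f] = (Ex f)%:E)%E.
Proof.
move=> Mf; rewrite unlock /Ex /Rintegral fineK//.
exact: (integrable_fin_num measurableT (moments_int Mf)).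
Qed.

Lemma Ex_cst c : Ex (fun=> c) = c.
Proof. by have := expectation_cst P c; rewrite (Ex_EFin (moments_cst c)) => -[]. Qed.

Lemma ExD f g : moments f -> moments g ->
  Ex (fun w => f w + g w) = Ex f + Ex g.
Proof. by move=> Mf Mg; apply: RintegralD => //; exact: moments_int. Qed.

Lemma ExZ c f : moments f -> Ex (fun w => c * f w) = c * Ex f.
Proof. by move=> Mf; apply: RintegralZl => //; exact: moments_int. Qed.

Lemma ExB f g : moments f -> moments g ->
  Ex (fun w => f w - g w) = Ex f - Ex g.
Proof. by move=> Mf Mg; apply: RintegralB => //; exact: moments_int. Qed.

Lemma Ex_sum (I : Type) (s : seq I) (Q : pred I) (F : I -> T -> R) :
  (forall i, moments (F i)) ->
  Ex (fun w => \sum_(i <- s | Q i) F i w) = \sum_(i <- s | Q i) Ex (F i).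
Proof.
move=> MF; elim: s => [|i s IH].
  by under eq_fun do rewrite big_nil; rewrite big_nil; exact: Ex_cst.
under eq_fun do rewrite big_cons; rewrite big_cons.
case: (Q i) => //; rewrite ExD ?IH//; exact: moments_sum.
Qed.

Lemma le_Ex f g : moments f -> moments g -> (forall w, f w <= g w) ->
  Ex f <= Ex g.
Proof. by move=> Mf Mg h; apply: le_Rintegral => //; exact: moments_int. Qed.

Lemma Ex_ge0 f : (forall w, 0 <= f w) -> 0 <= Ex f.
Proof. by move=> h; apply: Rintegral_ge0. Qed.

Lemma eq_Ex f g : f =1 g -> Ex f = Ex g.
Proof. by move=> /funext ->. Qed.

Lemma Var_Ex f : moments f -> ('V_P[f] = (Ex (fun w => (f w - Ex f) ^+ 2)%R)%:E)%E.
Proof.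
move=> Mf; rewrite /variance unlock (Ex_EFin Mf) /= -Ex_EFin.
  by congr ('E_P[_])%E; apply/funext => w /=; rewrite expr2.
by apply/momentsX/momentsB => //; exact: moments_cst.
Qed.

End moments.

(** * Independence *)

Section pi_lambda.
Context (R : realType) (d : measure_display) (T : measurableType d)
  (P : probability T R).
Implicit Types (G H : set (set T)).

(** The two sides are finite measures in A that agree on a generating
    pi-system. *)
Lemma independent_sigmal G (B : set T) :
  setI_closed G -> G setT -> G `<=` measurable -> measurable B ->
  (forall A, G A -> P (A `&` B) = (P A * P B)%E) ->
  forall A, <<s G >> A -> P (A `&` B) = (P A * P B)%E.
Proof.
move=> GI GT Gm mB GB A sA.
have Pfin : P B \is a fin_num by exact: fin_num_measure.
have r0 : 0 <= fine (P B) by rewrite fine_ge0.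
pose r := NngNum r0.
have := @g_sigma_algebra_measure_unique _ _ _ G Gm (fun=> setT)
  (fun=> GT) _ (mrestr P mB) (mscale r P) GI _ _ A sA.
rewrite /mrestr/= /mscale/= fineK// muleC; apply.
- by rewrite bigcup_const//; exists 0%N.
- by move=> X GX; rewrite /mrestr/= GB// muleC.
- by move=> _; rewrite /mrestr/= setTI ltey_eq Pfin.
Qed.

(** The one-sided extension, applied to each of the two arguments in turn. *)
Lemma independent_sigma G H :
  setI_closed G -> G setT -> G `<=` measurable ->
  setI_closed H -> H setT -> H `<=` measurable ->
  independent2 P G H -> independent2 P <<s G >> <<s H >>.
Proof.
move=> GI GT Gm HI HT Hm GH A B sA sB.
apply: (independent_sigmal GI GT Gm _ _ sA).
  by apply: smallest_sub sB => //; exact: sigma_algebra_measurable.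
move=> A' GA'; rewrite setIC muleC.
apply: (independent_sigmal HI HT Hm _ _ sB); first exact: Gm.
by move=> B' HB'; rewrite setIC muleC; exact: GH.
Qed.

Lemma independent2S G G' H H' : G `<=` G' -> H `<=` H' ->
  independent2 P G' H' -> independent2 P G H.
Proof. by move=> GG HH GH A B /GG ? /HH ?; exact: GH. Qed.

End pi_lambda.

(** Only generators of the sigma-algebra of the indices in A: the
    measurability predicate [gmeas] and the independence lemmas generate it. *)
Definition gen_of (T : Type) (I : Type) (F : I -> set (set T)) (A : set I) :
  set (set T) := \bigcup_(i in A) F i.

Section blocks.
Context (R : realType) (d : measure_display) (T : measurableType d)
  (P : probability T R) (I : finType) (F : I -> set (set T)).
Hypothesis Fsig : forall i, sigma_algebra setT (F i).
Hypothesis Fm : forall i, F i `<=` measurable.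
Hypothesis Find : mutually_independent P F.

Let boxes (A : set I) : set (set T) := [set X | exists E : I -> set T,
  [/\ forall i, F i (E i), forall i, ~ A i -> E i = setT &
      X = \bigcap_i E i]].

Let FT i : F i setT.
Proof. by have [F0 FC _] := Fsig i; have := FC _ F0; rewrite setD0. Qed.

Let FI i : setI_closed (F i).
Proof.
move=> X Y; rewrite -(sigma_algebra_id (Fsig i)).
exact: (@measurableI _ (g_sigma_algebraType (F i))).
Qed.

Let boxesI A : setI_closed (boxes A).
Proof.
move=> _ _ [E [FE ET ->]] [E' [FE' ET' ->]].
exists (fun i => E i `&` E' i); split.
- by move=> i; exact: FI.
- by move=> i Ai; rewrite ET// ET'// setIT.
- by rewrite bigcapI.
Qed.

Let boxesT A : boxes A setT.
Proof. by exists (fun=> setT); split => //; rewrite bigcapT. Qed.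

Let boxesm A : boxes A `<=` measurable.
Proof.
move=> _ [E [FE _ ->]].
by apply: fin_bigcap_measurable => // i _; exact: Fm (FE i).
Qed.

Let Pbox E : (forall i, F i (E i)) ->
  P (\bigcap_i E i) = (\prod_(i : I) P (E i))%E.
Proof.
move=> FE; have := Find (enum_uniq I) (fun i _ => FE i).
rewrite big_enum /= => <-; congr (P _).
apply/seteqP; split=> w Ew i _; apply: Ew => //=.
by rewrite mem_enum.
Qed.

(** Grouping: variables built from disjoint sets of independent observations
    are independent. The boxes (intersections of one event per index, trivial
    outside the set) form a generating pi-system on which the product rule is
    the assumption. *)
Lemma block_independent A B : A `&` B = set0 ->
  independent2 P <<s gen_of F A >> <<s gen_of F B >>.
Proof.
move=> AB0.
have sub C : gen_of F C `<=` boxes C.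
  move=> X [i Ci FX]; exists (fun j => if j == i then X else setT); split.
  - by move=> j; case: eqP => [->|].
  - by move=> j Cj; case: eqP => // ji; rewrite ji in Cj.
  - apply/seteqP; split => w; first by move=> Xw j _ /=; case: eqP.
    by move=> /(_ i Logic.I) /=; rewrite eqxx.
apply: (@independent2S _ _ _ P _ <<s boxes A >> _ <<s boxes B >>);
  [exact: sub_sigma_algebra2..|].
apply: independent_sigma => //.
move=> _ _ [E [FE ET ->]] [E' [FE' ET' ->]].
rewrite -bigcapI !Pbox//; last by move=> i; exact: FI.
rewrite -big_split /=; apply: eq_bigr => i _.
have [Ai|nAi] := pselect (A i).
  have nBi : ~ B i by move=> Bi; have : (A `&` B) i by []; rewrite AB0.
  by rewrite (ET' _ nBi) setIT probability_setT mule1.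
by rewrite (ET _ nAi) setTI probability_setT mul1e.
Qed.

End blocks.

Section functional_independence.
Context (R : realType) (d : measure_display) (T : measurableType d)
  (P : probability T R).
Implicit Types (G : set (set T)) (f g : T -> R).

Definition gmeas G f :=
  measurable_fun (setT : set (g_sigma_algebraType G)) (f : g_sigma_algebraType G -> R).

Lemma gmeas_cst G c : gmeas G (cst c).
Proof. exact: measurable_cst. Qed.

Lemma gmeasD G f g : gmeas G f -> gmeas G g -> gmeas G (fun w => f w + g w).
Proof. exact: measurable_funD. Qed.

Lemma gmeasB G f g : gmeas G f -> gmeas G g -> gmeas G (fun w => f w - g w).
Proof. exact: measurable_funB. Qed.

Lemma gmeasM G f g : gmeas G f -> gmeas G g -> gmeas G (fun w => f w * g w).
Proof. exact: measurable_funM. Qed.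

Lemma gmeasX G f n : gmeas G f -> gmeas G (fun w => f w ^+ n).
Proof. exact: measurable_funX. Qed.

Lemma gmeas_comp G f (h : R -> R) : measurable_fun setT h ->
  gmeas G f -> gmeas G (fun w => h (f w)).
Proof. by move=> mh mf; exact: measurableT_comp. Qed.

Lemma gmeas_sum G (I : Type) (s : seq I) (Q : pred I) (F : I -> T -> R) :
  (forall i, Q i -> gmeas G (F i)) ->
  gmeas G (fun w => \sum_(i <- s | Q i) F i w).
Proof.
move=> MF; elim: s => [|i s IH].
  by under eq_fun do rewrite big_nil; exact: gmeas_cst.
under eq_fun do rewrite big_cons.
by case E: (Q i) => //; apply: gmeasD => //; exact: MF.
Qed.

Lemma gmeas_prod G (I : Type) (s : seq I) (Q : pred I) (F : I -> T -> R) :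
  (forall i, Q i -> gmeas G (F i)) ->
  gmeas G (fun w => \prod_(i <- s | Q i) F i w).
Proof.
move=> MF; elim: s => [|i s IH].
  by under eq_fun do rewrite big_nil; exact: gmeas_cst.
under eq_fun do rewrite big_cons.
by case E: (Q i) => //; apply: gmeasM => //; exact: MF.
Qed.

Lemma gmeasS G G' f : G `<=` <<s G' >> -> gmeas G f -> gmeas G' f.
Proof.
move=> GG mf _ A mA.
have sub : <<s G >> `<=` <<s G' >>.
  apply: smallest_sub GG. exact: (smallest_sigma_algebra setT G').
exact: sub (mf measurableT A mA).
Qed.

(** The law of the pair (f, g) is the product of the two laws, since they agree
    on rectangles; Fubini's theorem for the function x y on the plane then
    splits the expectation. *)
Lemma Ex_indep G1 G2 f g : independent2 P <<s G1 >> <<s G2 >> ->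
  gmeas G1 f -> gmeas G2 g -> moments P f -> moments P g ->
  Ex P (fun w => f w * g w) = Ex P f * Ex P g.
Proof.
move=> ind mf mg Mf Mg.
pose X : {mfun T >-> R} := mfun_Sub (mem_set (moments_meas Mf)).
pose Y : {mfun T >-> R} := mfun_Sub (mem_set (moments_meas Mg)).
have mXY : measurable_fun [set: T] (fun w => (f w, g w)).
  by apply/measurable_fun_pairP; split;
    [exact: (moments_meas Mf)|exact: (moments_meas Mg)].
pose Z : {mfun T >-> (R * R)%type} := mfun_Sub (mem_set mXY).
pose h (z : R * R) : \bar R := (z.1 * z.2)%:E.
have mh : measurable_fun setT h.
  apply/measurable_EFinP; apply: measurable_funM.
    exact: measurable_fst.
  exact: measurable_snd.
pose m1 := distribution P X; pose m2 := distribution P Y.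
have meq A : measurable A -> (m1 \x m2)%E A = distribution P Z A.
  apply: product_measure_unique => {}A B mA mB.
  rewrite /distribution /pushforward /=.
  have := ind (f @^-1` A) (g @^-1` B); rewrite /m1 /m2 => <-//.
    by have := mf measurableT A mA; rewrite setTI.
  by have := mg measurableT B mB; rewrite setTI.
have ih : (m1 \x m2)%E.-integrable setT h.
  apply/integrableP; split => //.
  rewrite (eq_measure_integral (distribution P Z)); last by move=> A mA _; exact: meq.
  rewrite ge0_integral_distribution//; last exact: measurableT_comp.
  by have /integrableP[_] := moments_int (momentsM Mf Mg).
have -> : Ex P (fun w => f w * g w) = fine (\int[m1 \x m2]_z h z)%E.
  rewrite (eq_measure_integral (distribution P Z)); last by move=> A mA _; exact: meq.
  rewrite integral_distribution//; exact: (moments_int (momentsM Mf Mg)).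
rewrite -integral12_prod_meas1// /fubini_F /h /=.
have iY : (\int[m2]_y (y%:E) = (Ex P g)%:E)%E.
  rewrite /m2 integral_distribution//; last exact: moments_int Mg.
  by rewrite -Ex_EFin// unlock.
have iX : (\int[m1]_y (y%:E) = (Ex P f)%:E)%E.
  rewrite /m1 integral_distribution//; last exact: moments_int Mf.
  by rewrite -Ex_EFin// unlock.
have jX : m1.-integrable setT (EFin : R -> \bar R).
  apply: (integrable_pushforward (moments_meas Mf)) => //.
  exact: (moments_int Mf).
have jY : m2.-integrable setT (EFin : R -> \bar R).
  apply: (integrable_pushforward (moments_meas Mg)) => //.
  exact: (moments_int Mg).
transitivity (fine (\int[m1]_x ((Ex P g)%:E * x%:E))%E).
  congr fine; apply: eq_integral => x _.
  by under eq_integral do rewrite EFinM; rewrite integralZl// iY muleC.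
by rewrite integralZl// iX /= mulrC.
Qed.

End functional_independence.

(** * Gaussian random variables *)

Section normal_mgf.
Context (R : realType).
Local Notation mu := (@lebesgue_measure R).

(** The normal density is a Radon-Nikodym derivative, almost everywhere equal
    to the one that the change of variables formula uses. *)
Lemma ge0_integral_normal_prob (m s : R) (f : R -> \bar R) : s != 0 ->
  (forall x, 0 <= f x)%E -> measurable_fun setT f ->
  (\int[normal_prob m s]_x f x = \int[mu]_x (f x * (normal_pdf m s x)%:E))%E.
Proof.
move=> s0 f0 mf.
have dom := normal_prob_dominates m s.
rewrite -(Radon_Nikodym_SigmaFinite.change_of_variables dom f0 measurableT mf).
have ig := Radon_Nikodym_SigmaFinite.f_integrable dom.
have mpdf : measurable_fun setT (fun x => (normal_pdf m s x)%:E).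
  by apply/measurable_EFinP; exact: measurable_normal_pdf.
apply: ae_eq_integral => //.
- by apply: emeasurable_funM => //; exact: (measurable_int mu).
- exact: emeasurable_funM.
- apply: ae_eqe_mul2l; apply: integral_ae_eq => //.
  by move=> E _ mE; rewrite -(Radon_Nikodym_SigmaFinite.f_integral dom).
Qed.

(** Completing the square: the exponential tilt of a normal density is, up to
    the constant on the right, the density with the mean shifted by t s^2. *)
Lemma normal_prob_mgf (m s t : R) : s != 0 ->
  (\int[normal_prob m s]_x (expR (t * (x - m)))%:E =
   (expR (t ^+ 2 * s ^+ 2 / 2))%:E)%E.
Proof.
move=> s0; rewrite ge0_integral_normal_prob//; last first.
  apply/measurable_EFinP; apply: measurableT_comp => //.
  by apply: measurable_funM => //; exact: measurable_funB.
transitivity (\int[mu]_x ((expR (t ^+ 2 * s ^+ 2 / 2))%:E *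
    (normal_pdf (m + t * s ^+ 2) s x)%:E))%E.
  apply: eq_integral => x _; rewrite -!EFinM; congr EFin.
  rewrite !normal_pdfE// mulrCA [RHS]mulrCA; congr (_ * _).
  rewrite /normal_fun -!expRD; congr expR.
  by field.
rewrite integralZl//; last exact: integrable_normal_pdf.
by rewrite integral_normal_pdf mule1.
Qed.

End normal_mgf.

Section gauss.
Context (R : realType) (d : measure_display) (T : measurableType d)
  (P : probability T R).
Implicit Types f g : T -> R.

(** The centred normal law with variance v, characterized by its moment
    generating function. Variance 0 is included, so that scaling and
    independent sums need no case distinction for null coefficients. *)
Definition gauss f v := measurable_fun setT f /\
  forall t, (\int[P]_w (expR (t * f w))%:E = (expR (v * t ^+ 2 / 2))%:E)%E.

Lemma gauss_exp f v t : gauss f v -> moments P (fun w => expR (t * f w)).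
Proof.
move=> [mf Ef].
have mE c : measurable_fun setT (fun w => expR (c * f w)).
  by apply: measurableT_comp => //; exact: measurable_funM.
split=> // p; apply/integrableP; split.
  by apply/measurable_EFinP/measurable_funX/measurableT_comp.
rewrite (eq_integral (fun w => (expR ((p%:R * t) * f w))%:E)) ?Ef ?ltry// => w _.
by rewrite /= normrX normr_id ger0_norm ?expR_ge0// -mulrA expRM_natl.
Qed.

Lemma Ex_gauss_exp f v t : gauss f v ->
  Ex P (fun w => expR (t * f w)) = expR (v * t ^+ 2 / 2).
Proof. by move=> [_ Ef]; rewrite /Ex /Rintegral Ef. Qed.

Lemma expR_pow_bound (x : R) p : 0 <= x -> x ^+ p <= p%:R ^+ p * expR x.
Proof.
move=> x0; case: p => [|p].
  by rewrite !expr0 mul1r -expR0 ler_expR.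
have p0 : 0 < p.+1%:R :> R by [].
have -> : x = p.+1%:R * (x / p.+1%:R) by rewrite mulrCA divff ?mulr1 ?gt_eqF.
rewrite [in leRHS]expRM_natl exprMn ler_pM2l ?exprn_gt0//.
rewrite lerXn2r ?nnegrE ?expR_ge0 ?divr_ge0//.
by apply: le_trans (expR_ge1Dx _); rewrite lerDr.
Qed.

(** The exponentials of f and of - f dominate every power of f. *)
Lemma gauss_moments f v : gauss f v -> moments P f.
Proof.
move=> gf; have [mf _] := gf; split=> // p.
have I1 := integrableD measurableT (moments_int (gauss_exp 1 gf))
  (moments_int (gauss_exp (-1) gf)).
have I2 := integrableZl measurableT (p%:R ^+ p : R) I1.
apply: (le_integrable measurableT _ _ I2).
  by apply/measurable_EFinP/measurable_funX/measurableT_comp.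
move=> w _ /=; rewrite lee_fin normrX normr_id [leRHS]ger0_norm; last first.
  by rewrite mulr_ge0 ?exprn_ge0// addr_ge0 ?expR_ge0.
apply: le_trans (expR_pow_bound _ _) _ => //.
rewrite ler_wpM2l ?exprn_ge0// mul1r mulN1r.
by case: ger0P => _; rewrite ?lerDl ?lerDr expR_ge0.
Qed.

Lemma gauss0 : gauss (fun=> 0) 0.
Proof.
split; first exact: measurable_cst.
move=> t; under eq_integral do rewrite mulr0 expR0.
by rewrite integral_cst//= probability_setT mule1 !mul0r expR0.
Qed.

Lemma gaussZ c f v : gauss f v -> gauss (fun w => c * f w) (c ^+ 2 * v).
Proof.
move=> [mf Ef]; split; first exact: measurable_funM.
move=> t; under eq_integral do rewrite mulrA.
by rewrite Ef; congr (expR _)%:E; ring.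
Qed.

(** Moment generating functions of independent variables multiply. *)
Lemma gaussD G1 G2 f g v1 v2 : independent2 P <<s G1 >> <<s G2 >> ->
  gmeas G1 f -> gmeas G2 g -> gauss f v1 -> gauss g v2 ->
  gauss (fun w => f w + g w) (v1 + v2).
Proof.
move=> ind m1 m2 gf gg; have [mf Ef] := gf; have [mg Eg] := gg.
split; first exact: measurable_funD.
move=> t; under eq_integral do rewrite mulrDr expRD.
have M := momentsM (gauss_exp t gf) (gauss_exp t gg).
have := Ex_EFin M; rewrite unlock => ->.
have mexp : measurable_fun [set: R] (fun x : R => expR (t * x)).
  by apply: measurableT_comp => //; exact: measurable_funM.
have /= -> := Ex_indep ind (gmeas_comp mexp m1) (gmeas_comp mexp m2)
  (gauss_exp t gf) (gauss_exp t gg).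
rewrite (Ex_gauss_exp _ gf) (Ex_gauss_exp _ gg).
by rewrite -expRD; congr (expR _)%:E; ring.
Qed.

Lemma gauss_normal f m s : s != 0 -> measurable_fun setT f ->
  (forall A, measurable A -> P (f @^-1` A) = normal_prob m s A) ->
  gauss (fun w => f w - m) (s ^+ 2).
Proof.
move=> s0 mf Pf; split; first exact: measurable_funB.
move=> t.
(* [normal_prob] lives on a copy of the line that carries another, convertible,
   Borel structure. *)
have mf' : @measurable_fun _ _ T (measurableTypeR R) setT f := mf.
have mexp : measurable_fun [set: measurableTypeR R]
    (fun x : R => (expR (t * (x - m)))%:E).
  apply/measurable_EFinP; apply: measurableT_comp => //.
  by apply: measurable_funM => //; exact: measurable_funB.
have ge0 x : x \in [set: measurableTypeR R] -> (0 <= (expR (t * (x - m)))%:E)%E.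
  by move=> _; rewrite lee_fin expR_ge0.
rewrite -[LHS](ge0_integral_pushforward mf' P measurableT mexp ge0).
rewrite -(_ : (\int[normal_prob m s]_x (expR (t * (x - m)))%:E =
   (expR (s ^+ 2 * t ^+ 2 / 2))%:E)%E); last first.
  by rewrite normal_prob_mgf// [t ^+ 2 * _]mulrC.
by apply: eq_measure_integral => A mA _; exact: Pf.
Qed.

Section derivatives.
Variables (f : T -> R) (v : R) (gf : gauss f v).

Let Gk k t := Ex P (fun w => f w ^+ k * expR (t * f w)).

Let MG k t : moments P (fun w => f w ^+ k * expR (t * f w)).
Proof. by apply: momentsM (gauss_exp t gf); apply/momentsX/gauss_moments/gf. Qed.

(** Differentiation under the integral sign. For x in ]t - 1, t + 1[ the
    derivative in x is dominated by |f|^(k+1) (e^((t-1) f) + e^((t+1) f)). *)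
Let dG k (t : R) : is_derive t (1 : R) (Gk k) (Gk k.+1 t).
Proof.
pose F t w := f w ^+ k * expR (t * f w).
pose B w := `|f w| ^+ k.+1 * (expR ((t - 1) * f w) + expR ((t + 1) * f w)).
have It : (`]t - 1, t + 1[%classic : set R) t by rewrite /= in_itv/=; lra.
have dF (x : R) w :
    is_derive x (1 : R) (F ^~ w) (f w ^+ k.+1 * expR (x * f w)).
  have -> : F ^~ w = f w ^+ k \*: (expR \o (f w \*: (id : R -> R))).
    by apply/funext => y; rewrite /F /= mulrC mulrC [y * _]mulrC.
  have h1 : is_derive x (1 : R) (f w \*: (id : R -> R)) (f w *: 1).
    exact: is_deriveZ.
  have h2 := is_derive1_comp (is_derive_expR _) h1.
  have := is_deriveZ (f w ^+ k) h2.
  by congr (is_derive _ _ _ _); rewrite /= exprS /GRing.scale /= [f w * x]mulrC; ring.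
have FE x w : partial1of2 F x w = f w ^+ k.+1 * expR (x * f w).
  by rewrite partial1of2E; apply: derive_val.
have intF x : (`]t - 1, t + 1[%classic : set R) x -> P.-integrable setT (EFin \o F x).
  by move=> _; exact: (moments_int (MG k x)).
have dF1 x w : (`]t - 1, t + 1[%classic : set R) x -> [set: T] w -> derivable (F ^~ w) x 1.
  by move=> _ _; exact: ex_derive.
have B0 w : 0 <= B w.
  by rewrite mulr_ge0 ?exprn_ge0 ?addr_ge0 ?expR_ge0.
have MB : moments P B.
  apply: momentsM; last by apply: momentsD; exact: gauss_exp gf.
  have [mf If] := gauss_moments gf.
  split; first exact/measurable_funX/measurableT_comp.
  move=> p; have := If (k.+1 * p)%N; congr (_.-integrable _ _).
  by apply/funext => w /=; rewrite exprM normrX normr_id.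
have leB x w : (`]t - 1, t + 1[%classic : set R) x -> [set: T] w ->
    `|partial1of2 F x w| <= B w.
  rewrite /= in_itv/= => /andP[x1 x2] _.
  rewrite FE normrM normrX ler_wpM2l ?exprn_ge0// ger0_norm ?expR_ge0//.
  have [fw|fw] := leP 0 (f w).
    apply: (@le_trans _ _ (expR ((t + 1) * f w))); last by rewrite lerDr expR_ge0.
    by rewrite ler_expR ler_wpM2r// ltW.
  apply: (@le_trans _ _ (expR ((t - 1) * f w))); last by rewrite lerDl expR_ge0.
  by rewrite ler_expR ler_wnM2r// ltW.
apply: DeriveDef.
  exact: (derivable_under_integral measurableT It intF dF1 B0 (moments_int MB) leB).
rewrite -derive1E.
rewrite (differentiation_under_integral measurableT It intF dF1 B0 (moments_int MB) leB).
by apply: eq_Rintegral => w _; rewrite FE.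
Qed.

(** The derivatives Gk of the moment generating function inherit from
    Gk 1 t = v t Gk 0 t the recursion of the Hermite polynomials; at t = 0 it
    gives the moments 1, 0, v, 0, 3 v^2, 0, 15 v^3. *)
Let recG k : forall t, Gk k.+1 t = v * (t * Gk k t + k%:R * Gk k.-1 t).
Proof.
elim: k => [|k IH] t.
  have h : is_derive t (1 : R) (fun t : R => expR (v * t ^+ 2 / 2)) (v * t * Gk 0 t).
    have -> : (fun t : R => expR (v * t ^+ 2 / 2)) =
        expR \o ((v / 2) \*: ((id : R -> R) ^+ 2)).
      by apply/funext => x /=; congr expR; rewrite /GRing.scale /= !fctE; ring.
    have h1 := is_deriveX 2 (is_derive_id t (1 : R)).
    have h2 := is_deriveZ (v / 2) h1.
    have := is_derive1_comp (is_derive_expR _) h2.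
    congr (is_derive _ _ _ _); rewrite /Gk (_ : Ex P _ = expR (v * t ^+ 2 / 2)).
      rewrite /= /GRing.scale /= !fctE.
      rewrite (_ : v / 2 * t ^+ 2 = v * t ^+ 2 / 2); last by ring.
      by field.
    by rewrite -(Ex_gauss_exp t gf); apply: eq_Ex => w; rewrite expr0 mul1r.
  have G0E : Gk 0 = fun t => expR (v * t ^+ 2 / 2).
    apply/funext => x; rewrite -(Ex_gauss_exp x gf); apply: eq_Ex => w.
    by rewrite expr0 mul1r.
  have := @derive_val _ _ _ _ _ _ _ (dG 0 t); rewrite {1}G0E => <-.
  by rewrite (@derive_val _ _ _ _ _ _ _ h); ring.
have E : Gk k.+1 = fun t => v * (t * Gk k t + k%:R * Gk k.-1 t) by apply/funext.
have := @derive_val _ _ _ _ _ _ _ (dG k.+1 t); rewrite {1}E => <-.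
have h : is_derive t (1 : R) (fun t : R => v * (t * Gk k t + k%:R * Gk k.-1 t))
   (v * (t * Gk k.+1 t + Gk k t + k%:R * Gk k.-1.+1 t)).
  have := is_deriveZ v (is_deriveD (is_deriveM (is_derive_id t (1 : R)) (dG k t))
    (is_deriveZ k%:R (dG k.-1 t))).
  by congr (is_derive _ _ _ _); rewrite /GRing.scale /=; ring.
rewrite (@derive_val _ _ _ _ _ _ _ h) /=.
case: k {IH E h} => [|k] /=; first ring.
by rewrite -!natr1; ring.
Qed.

Let m0 : Gk 0 0 = 1.
Proof.
rewrite -[RHS](Ex_cst P 1); apply: eq_Ex => w.
by rewrite expr0 mul0r expR0 mulr1.
Qed.

Let mk k : Ex P (fun w => f w ^+ k) = Gk k 0.
Proof. by apply: eq_Ex => w; rewrite mul0r expR0 mulr1. Qed.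

Lemma gauss_m2 : Ex P (fun w => f w ^+ 2) = v.
Proof. by rewrite mk recG /= m0; ring. Qed.

Lemma gauss_m4 : Ex P (fun w => f w ^+ 4) = 3 * v ^+ 2.
Proof. by rewrite mk recG mul0r /= recG m0; ring. Qed.

Lemma gauss_m6 : Ex P (fun w => f w ^+ 6) = 15 * v ^+ 3.
Proof. by rewrite mk recG mul0r /= recG mul0r /= recG m0; ring. Qed.

End derivatives.

End gauss.

(** * Positive semidefinite matrices *)

Section bilin_theory.
Context (R : realType) (p : nat).
Implicit Types (u v z : 'cV[R]_p) (M S : 'M[R]_p).

Definition ip u v : R := (u^T *m v) 0 0.

Lemma ipE u v : ip u v = \sum_c u c 0 * v c 0.
Proof. by rewrite /ip mxE; apply: eq_bigr => c _; rewrite mxE. Qed.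

Lemma bilinE u M v : bilin u M v = \sum_c \sum_d u c 0 * M c d * v d 0.
Proof.
rewrite /bilin -mulmxA mxE; apply: eq_bigr => c _.
by rewrite !mxE mulr_sumr; apply: eq_bigr => d _; rewrite mulrA.
Qed.

Lemma bilin_ip u M v : bilin u M v = ip (M^T *m u) v.
Proof. by rewrite /bilin /ip trmx_mul trmxK. Qed.

Lemma bilinC u M v : bilin u M v = bilin v M^T u.
Proof.
rewrite !bilinE exchange_big; apply: eq_bigr => c _; apply: eq_bigr => d _.
by rewrite mxE mulrC mulrA mulrAC.
Qed.

Lemma bilinDl u1 u2 M v : bilin (u1 + u2) M v = bilin u1 M v + bilin u2 M v.
Proof. by rewrite /bilin raddfD /= !mulmxDl mxE. Qed.

Lemma bilinDr u M v1 v2 : bilin u M (v1 + v2) = bilin u M v1 + bilin u M v2.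
Proof. by rewrite /bilin !mulmxDr mxE. Qed.

Lemma bilinZl a u M v : bilin (a *: u) M v = a * bilin u M v.
Proof. by rewrite /bilin linearZ /= -!scalemxAl mxE. Qed.

Lemma bilinZr a u M v : bilin u M (a *: v) = a * bilin u M v.
Proof. by rewrite /bilin -scalemxAr mxE. Qed.

Lemma bilin_delta M c d : bilin (delta_mx c 0) M (delta_mx d 0) = M c d.
Proof. by rewrite /bilin trmx_delta -rowE -colE !mxE. Qed.

Lemma bilinBm u M N v : bilin u (M - N) v = bilin u M v - bilin u N v.
Proof. by rewrite /bilin mulmxBr mulmxBl !mxE. Qed.

Lemma bilinZm a u M v : bilin u (a *: M) v = a * bilin u M v.
Proof. by rewrite /bilin -scalemxAr -scalemxAl mxE. Qed.

Lemma bilin_conj u M N v : bilin u (M^T *m N *m M) v = bilin (M *m u) N (M *m v).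
Proof. by rewrite /bilin trmx_mul !mulmxA. Qed.

Lemma ipZl a u v : ip (a *: u) v = a * ip u v.
Proof. by rewrite /ip linearZ /= -scalemxAl mxE. Qed.

Lemma bilin_outer u b v : bilin u (b *m b^T) v = ip b u * ip b v.
Proof.
rewrite /bilin /ip !mulmxA -mulmxA [LHS]mxE big_ord1; congr (_ * _).
by rewrite -[u^T *m b]trmxK trmx_mul trmxK mxE.
Qed.

Lemma mxtrace_outer b S : \tr (b *m b^T *m S) = bilin b S b.
Proof. by rewrite -mulmxA mxtrace_mulC trace_mx11 /bilin -mulmxA. Qed.

Definition psd M := M^T = M /\ forall u, 0 <= bilin u M u.

(** The quadratic form at e_c + t e_d is 2 t M_cd, which has to be nonnegative
    for t = 1 and t = -1. *)
Lemma psd_diag0 M : psd M -> (forall c, M c c = 0) -> M = 0.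
Proof.
move=> [Ms M0] D0; apply/matrixP => c d; rewrite mxE.
have sy : M d c = M c d by rewrite -{1}Ms mxE.
have h (t : R) : 0 <= 2 * (t * M c d).
  have := M0 (delta_mx c 0 + t *: delta_mx d 0).
  rewrite bilinDl !bilinDr bilinZl !bilinZr bilinZl !bilin_delta !D0 sy.
  by congr (0 <= _); ring.
by have := h 1; have := h (-1); lra.
Qed.

(** One step of the Cholesky algorithm, in place: the reduced matrix is the
    Schur complement of the entry (c, c), padded with zeros. Zeros on the
    diagonal persist, so the number of nonzero diagonal entries decreases. *)
Lemma psd_reduce M c : psd M -> 0 < M c c ->
  let b := (Num.sqrt (M c c))^-1 *: col c M in
  [/\ psd (M - b *m b^T), b != 0, (M - b *m b^T) c c = 0 &
      forall d, M d d = 0 -> (M - b *m b^T) d d = 0].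
Proof.
move=> [Ms M0] Mc b.
have s0 : 0 < Num.sqrt (M c c) by rewrite sqrtr_gt0.
have ss : (Num.sqrt (M c c)) ^+ 2 = M c c by rewrite sqr_sqrtr// ltW.
have ipb u : ip b u = (Num.sqrt (M c c))^-1 * bilin (delta_mx c 0) M u.
  by rewrite /b ipZl bilin_ip Ms -colE.
have sqE u : ip b u * ip b u = bilin (delta_mx c 0) M u ^+ 2 / M c c.
  by rewrite !ipb -[in RHS]ss; field; rewrite gt_eqF.
have P1 : psd (M - b *m b^T).
  split; first by rewrite raddfB /= trmx_mul trmxK Ms.
  move=> u; rewrite bilinBm bilin_outer sqE.
  set x := bilin (delta_mx c 0) M u.
  have := M0 (u + (- (x / M c c)) *: delta_mx c 0).
  rewrite bilinDl !bilinDr bilinZl !bilinZr bilinZl bilin_delta.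
  rewrite [bilin u M (delta_mx c 0)]bilinC Ms -/x.
  congr (0 <= _).
  by field; rewrite gt_eqF.
have diag d : (M - b *m b^T) d d = M d d - (M c d) ^+ 2 / M c c.
  by rewrite -[LHS]bilin_delta bilinBm bilin_outer sqE !bilin_delta.
split => //.
- apply: contraTneq s0 => b0; have := congr1 (fun v : 'cV_p => v c 0) b0.
  rewrite !mxE => /eqP; rewrite mulf_eq0 invr_eq0 (gt_eqF Mc) orbF => /eqP ->.
  by rewrite ltxx.
- by rewrite diag expr2 mulfK ?subrr// gt_eqF.
- move=> d Md; apply/eqP; rewrite eq_le.
  (* The reduced diagonal entry is nonpositive by its formula and nonnegative
   because the reduced matrix is positive semidefinite. *)
  have := P1.2 (delta_mx d 0); rewrite bilin_delta => ->; rewrite andbT.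
  by rewrite diag Md sub0r oppr_le0 divr_ge0 ?sqr_ge0// ltW.
Qed.

(** Cholesky steps until the diagonal vanishes. The vectors are nonzero so that
    each linear form has positive variance under a positive definite
    covariance. *)
Lemma psd_sum_outer M : psd M -> exists2 s : seq 'cV[R]_p,
  (forall b, b \in s -> b != 0) & M = \sum_(b <- s) b *m b^T.
Proof.
have [n] := ubnP #|[pred c | M c c != 0]|; elim: n M => // n IH M Mn pM.
have [D0|/existsNP[c /eqP Mc]] := pselect (forall c, M c c = 0).
  by exists [::] => //; rewrite big_nil; exact: psd_diag0.
have Mc0 : 0 < M c c.
  by rewrite lt_neqAle eq_sym Mc -bilin_delta; exact: pM.2.
have [pM' b0 c0 d0] := psd_reduce pM Mc0.
set b := _ *: _ in pM' b0 c0 d0.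
have [|s sn0 Ms] := IH (M - b *m b^T) _ pM'.
  rewrite ltnS in Mn; apply: leq_trans Mn; apply: proper_card.
  apply/properP; split.
    apply/fintype.subsetP => d; rewrite !inE; apply: contra_neq; exact: d0.
  by exists c; rewrite ?inE ?c0 ?eqxx ?Mc.
exists (b :: s); last by rewrite big_cons -Ms addrCA subrr addr0.
by move=> b'; rewrite inE => /predU1P[->//|]; exact: sn0.
Qed.

Lemma bilin_sum_outer (s : seq 'cV[R]_p) u :
  bilin u (\sum_(b <- s) b *m b^T) u = \sum_(b <- s) ip b u ^+ 2.
Proof.
rewrite /bilin mulmx_sumr mulmx_suml summxE; apply: eq_bigr => b _.
by rewrite -[LHS]/(bilin _ _ _) bilin_outer expr2.
Qed.

Lemma mxtrace_sum_outer (s : seq 'cV[R]_p) S :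
  \tr ((\sum_(b <- s) b *m b^T) *m S) = \sum_(b <- s) bilin b S b.
Proof.
rewrite mulmx_suml raddf_sum /=; apply: eq_bigr => b _.
exact: mxtrace_outer.
Qed.

End bilin_theory.

(** * Quadratic and bilinear forms of Gaussian vectors *)

Lemma amgm3 (R : realFieldType) (x y z : R) : 0 <= x -> 0 <= y -> 0 <= z ->
  3 * (x * y * z) <= x ^+ 3 + y ^+ 3 + z ^+ 3.
Proof.
move=> x0 y0 z0.
have : 0 <= (x + y + z) * ((x - y) ^+ 2 + (y - z) ^+ 2 + (z - x) ^+ 2).
  by rewrite mulr_ge0 ?addr_ge0 ?sqr_ge0.
have -> : (x + y + z) * ((x - y) ^+ 2 + (y - z) ^+ 2 + (z - x) ^+ 2) =
  2 * (x ^+ 3 + y ^+ 3 + z ^+ 3 - 3 * (x * y * z)) by ring.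
by rewrite pmulr_rge0// subr_ge0.
Qed.

Section gauss_vectors.
Context (R : realType) (d : measure_display) (T : measurableType d)
  (P : probability T R).
Implicit Types f g : T -> R.

(** The inequality of means for the standardized squares f^2/v1 and g^2/v2
    reduces the mixed moment to fourth moments. *)
Lemma Ex_gauss_sq2 f g v1 v2 : 0 < v1 -> 0 < v2 ->
  gauss P f v1 -> gauss P g v2 ->
  Ex P (fun w => f w ^+ 2 * g w ^+ 2) <= 3 * (v1 * v2).
Proof.
move=> v10 v20 gf gg.
have Mf := gauss_moments gf; have Mg := gauss_moments gg.
have h w : f w ^+ 2 * g w ^+ 2 <=
    (v2 / (2 * v1)) * f w ^+ 4 + (v1 / (2 * v2)) * g w ^+ 4.
  rewrite -subr_ge0.
  have -> : (v2 / (2 * v1)) * f w ^+ 4 + (v1 / (2 * v2)) * g w ^+ 4 -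
     f w ^+ 2 * g w ^+ 2 = (v2 * f w ^+ 2 - v1 * g w ^+ 2) ^+ 2 / (2 * v1 * v2).
    by field; rewrite !gt_eqF.
  by rewrite divr_ge0 ?sqr_ge0// !mulr_ge0// ltW.
apply: le_trans (le_Ex _ _ h) _.
- by apply: momentsM; exact: momentsX.
- by apply: momentsD; apply/momentsZ/momentsX.
rewrite ExD ?ExZ ?(gauss_m4 gf) ?(gauss_m4 gg); try exact: momentsX.
  by rewrite le_eqVlt; apply/orP; left; apply/eqP; field; rewrite !gt_eqF.
all: by apply/momentsZ/momentsX.
Qed.

(** As for two factors, with [amgm3] for the standardized squares. *)
Lemma Ex_gauss_sq3 f1 f2 f3 v1 v2 v3 : 0 < v1 -> 0 < v2 -> 0 < v3 ->
  gauss P f1 v1 -> gauss P f2 v2 -> gauss P f3 v3 ->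
  Ex P (fun w => f1 w ^+ 2 * f2 w ^+ 2 * f3 w ^+ 2) <= 15 * (v1 * v2 * v3).
Proof.
move=> v10 v20 v30 g1 g2 g3.
have M1 := gauss_moments g1; have M2 := gauss_moments g2.
have M3 := gauss_moments g3.
(* Scales the inequality of means for standardized squares back. *)
pose k := v1 * v2 * v3 / 3.
have k0 : 0 < k by rewrite divr_gt0 ?mulr_gt0.
have h w : f1 w ^+ 2 * f2 w ^+ 2 * f3 w ^+ 2 <=
    k / v1 ^+ 3 * f1 w ^+ 6 + k / v2 ^+ 3 * f2 w ^+ 6 + k / v3 ^+ 3 * f3 w ^+ 6.
  have := @amgm3 _ (f1 w ^+ 2 / v1) (f2 w ^+ 2 / v2) (f3 w ^+ 2 / v3).
  move=> /(_ (divr_ge0 (sqr_ge0 _) (ltW v10)) (divr_ge0 (sqr_ge0 _) (ltW v20))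
    (divr_ge0 (sqr_ge0 _) (ltW v30))) am.
  have -> : f1 w ^+ 2 * f2 w ^+ 2 * f3 w ^+ 2 = k *
      (3 * (f1 w ^+ 2 / v1 * (f2 w ^+ 2 / v2) * (f3 w ^+ 2 / v3))).
    by rewrite /k; field; rewrite !gt_eqF.
  have -> : k / v1 ^+ 3 * f1 w ^+ 6 + k / v2 ^+ 3 * f2 w ^+ 6 +
      k / v3 ^+ 3 * f3 w ^+ 6 = k * ((f1 w ^+ 2 / v1) ^+ 3 +
      (f2 w ^+ 2 / v2) ^+ 3 + (f3 w ^+ 2 / v3) ^+ 3).
    by field; rewrite !gt_eqF.
  by rewrite ler_pM2l.
apply: le_trans (le_Ex _ _ h) _.
- by apply: momentsM; [apply: momentsM|]; exact: momentsX.
- by apply: momentsD; [apply: momentsD|]; apply/momentsZ/momentsX.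
rewrite !ExD ?ExZ ?(gauss_m6 g1) ?(gauss_m6 g2) ?(gauss_m6 g3);
  try by [apply: momentsX|apply/momentsZ/momentsX|
          apply: momentsD; apply/momentsZ/momentsX].
by rewrite le_eqVlt; apply/orP; left; apply/eqP; rewrite /k; field; rewrite !gt_eqF.
Qed.

Section sums_of_squares.
Variables (I : eqType) (s : seq I) (f : I -> T -> R) (v : I -> R).
Hypothesis v0 : forall i, i \in s -> 0 < v i.
Hypothesis gf : forall i, gauss P (f i) (v i).

Let M2 i : moments P (fun w => f i w ^+ 2).
Proof. by apply/momentsX/gauss_moments/gf. Qed.

Lemma Ex_sumsq2 :
  Ex P (fun w => (\sum_(i <- s) f i w ^+ 2) ^+ 2) <=
  3 * (\sum_(i <- s) v i) ^+ 2.
Proof.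
under [X in Ex P X]eq_fun => w.
  rewrite expr2 big_distrlr /=; over.
rewrite Ex_sum; last first.
  by move=> i; apply: moments_sum => j; exact: momentsM.
rewrite expr2 big_distrlr mulr_sumr /= big_seq [leRHS]big_seq.
apply: ler_sum => i si; rewrite Ex_sum; last by move=> j; exact: momentsM.
rewrite mulr_sumr big_seq [leRHS]big_seq; apply: ler_sum => j sj.
by apply: Ex_gauss_sq2 => //; exact: v0.
Qed.

Lemma Ex_sumsq3 :
  Ex P (fun w => (\sum_(i <- s) f i w ^+ 2) ^+ 3) <=
  15 * (\sum_(i <- s) v i) ^+ 3.
Proof.
have cube (F : I -> R) : (\sum_(i <- s) F i) ^+ 3 =
    \sum_(i <- s) \sum_(j <- s) \sum_(k <- s) F i * F j * F k.
  rewrite !exprS expr0 mulr1 big_distrlr /= mulr_suml.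
  apply: eq_bigr => i _; rewrite mulr_sumr; apply: eq_bigr => j _.
  by rewrite mulr_sumr; apply: eq_bigr => k _; rewrite mulrA.
have M3 i j k : moments P (fun w => f i w ^+ 2 * f j w ^+ 2 * f k w ^+ 2).
  by apply: momentsM => //; exact: momentsM.
under [X in Ex P X]eq_fun => w do rewrite cube.
rewrite Ex_sum; last first.
  by move=> i; apply: moments_sum => j; apply: moments_sum => k.
rewrite cube mulr_sumr big_seq [leRHS]big_seq; apply: ler_sum => i si.
rewrite Ex_sum; last by move=> j; apply: moments_sum => k.
rewrite mulr_sumr big_seq [leRHS]big_seq; apply: ler_sum => j sj.
rewrite Ex_sum//.
rewrite mulr_sumr big_seq [leRHS]big_seq; apply: ler_sum => k sk.
by apply: Ex_gauss_sq3 => //; exact: v0.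
Qed.

End sums_of_squares.

Context (p : nat).
Implicit Types (Z Y : T -> 'cV[R]_p) (S M A : 'M[R]_p).

(** Gaussian vectors by the Cramer-Wold device: every linear form is a centred
    Gaussian variable. *)
Definition gvec G Z S := (forall c, gmeas G (fun w => Z w c 0)) /\
  forall u, gauss P (fun w => ip u (Z w)) (bilin u S u).

Definition vmoments Z := forall c, moments P (fun w => Z w c 0).

Lemma gvec_vmoments G Z S : gvec G Z S -> vmoments Z.
Proof.
move=> [_ gZ] c; have := gauss_moments (gZ (delta_mx c 0)); congr moments.
by apply/funext => w; rewrite /ip trmx_delta -rowE mxE.
Qed.

Lemma moments_ip Z Y : vmoments Z -> vmoments Y ->
  moments P (fun w => ip (Z w) (Y w)).
Proof.
move=> mZ mY; under eq_fun do rewrite ipE.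
by apply: moments_sum => c; exact: momentsM.
Qed.

Lemma vmoments_mulmx A Y : vmoments Y -> vmoments (fun w => A *m Y w).
Proof.
move=> mY c; under eq_fun do rewrite mxE.
by apply: moments_sum => k; exact: momentsZ.
Qed.

Lemma moments_bilin Z M Y : vmoments Z -> vmoments Y ->
  moments P (fun w => bilin (Z w) M (Y w)).
Proof.
move=> mZ mY; under eq_fun do rewrite bilin_ip.
by apply: moments_ip => //; exact: vmoments_mulmx.
Qed.

Definition gvmeas G Z := forall c, gmeas G (fun w => Z w c 0).

Lemma gmeas_ip G Z Y : gvmeas G Z -> gvmeas G Y ->
  gmeas G (fun w => ip (Z w) (Y w)).
Proof.
move=> mZ mY; under eq_fun do rewrite ipE.
by apply: gmeas_sum => c _; exact: gmeasM.
Qed.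

Lemma gvmeas_mulmx G A Y : gvmeas G Y -> gvmeas G (fun w => A *m Y w).
Proof.
move=> mY c; under eq_fun do rewrite mxE.
by apply: gmeas_sum => k _; apply: gmeasM => //; exact: gmeas_cst.
Qed.

Lemma gmeas_bilin G Z M Y : gvmeas G Z -> gvmeas G Y ->
  gmeas G (fun w => bilin (Z w) M (Y w)).
Proof.
move=> mZ mY; under eq_fun do rewrite bilin_ip.
by apply: gmeas_ip => //; exact: gvmeas_mulmx.
Qed.

(** Polarization of the variances of the forms along e_c, e_k and e_c + e_k. *)
Lemma Ex_gvec2 G Z S c k : S^T = S -> gvec G Z S ->
  Ex P (fun w => Z w c 0 * Z w k 0) = S c k.
Proof.
move=> Ss gZ; have mZ := gvec_vmoments gZ; have [_ gS] := gZ.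
have ipd u w : ip (delta_mx u 0) (Z w) = Z w u 0.
  by rewrite /ip trmx_delta -rowE mxE.
pose u := delta_mx c 0 : 'cV[R]_p; pose v := delta_mx k 0 : 'cV[R]_p.
have E : (fun w => Z w c 0 * Z w k 0) = (fun w => 2^-1 *
    (ip (u + v) (Z w) ^+ 2 - ip u (Z w) ^+ 2 - ip v (Z w) ^+ 2)).
  apply/funext => w.
  have -> : ip (u + v) (Z w) = ip u (Z w) + ip v (Z w).
    by rewrite /ip raddfD /= mulmxDl mxE.
  by rewrite !ipd; field.
have MX x : moments P (fun w => ip x (Z w) ^+ 2).
  exact/momentsX/gauss_moments/gS.
rewrite E ExZ; last by apply: momentsB => //; exact: momentsB.
rewrite !ExB//; last exact: momentsB.
rewrite !(gauss_m2 (gS _)) bilinDl !bilinDr /u /v !bilin_delta.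
have -> : S k c = S c k by rewrite -{1}Ss mxE.
by field.
Qed.

Lemma Ex_bilin_gvec G Z S M : S^T = S -> gvec G Z S ->
  Ex P (fun w => bilin (Z w) M (Z w)) = \tr (M *m S).
Proof.
move=> Ss gZ; have mZ := gvec_vmoments gZ.
under [X in Ex P X]eq_fun do rewrite bilinE.
have Mcd c k : moments P (fun w => Z w c 0 * M c k * Z w k 0).
  by apply: momentsM => //; apply: momentsM => //; exact: moments_cst.
rewrite Ex_sum; last by move=> c; apply: moments_sum.
apply: eq_bigr => c _; rewrite mxE Ex_sum//; apply: eq_bigr => k _.
under [X in Ex P X]eq_fun do rewrite mulrAC mulrC.
rewrite ExZ; last exact: momentsM.
by rewrite (Ex_gvec2 _ _ Ss gZ) -{1}Ss mxE.
Qed.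

(** Conditioning on Y1, Y2 and g without conditional expectations: in
    coordinates the integrand is a finite sum of products of a function of Z
    with a function of the others. *)
Lemma Ex_decouple_bilin G1 G2 Z S Y1 Y2 g :
  independent2 P <<s G1 >> <<s G2 >> -> S^T = S -> gvec G1 Z S ->
  gvmeas G2 Y1 -> gvmeas G2 Y2 -> gmeas G2 g ->
  vmoments Y1 -> vmoments Y2 -> moments P g ->
  Ex P (fun w => ip (Y1 w) (Z w) * ip (Y2 w) (Z w) * g w) =
  Ex P (fun w => bilin (Y1 w) S (Y2 w) * g w).
Proof.
move=> ind Ss gZ mY1 mY2 mg MY1 MY2 Mg.
have MZ := gvec_vmoments gZ; have [mZ _] := gZ.
have L w : ip (Y1 w) (Z w) * ip (Y2 w) (Z w) * g w =
    \sum_c \sum_k (Z w c 0 * Z w k 0) * (Y1 w c 0 * Y2 w k 0 * g w).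
  rewrite !ipE big_distrlr /= mulr_suml; apply: eq_bigr => c _.
  by rewrite mulr_suml; apply: eq_bigr => k _; ring.
have Rr w : bilin (Y1 w) S (Y2 w) * g w =
    \sum_c \sum_k S c k * (Y1 w c 0 * Y2 w k 0 * g w).
  rewrite bilinE mulr_suml; apply: eq_bigr => c _.
  by rewrite mulr_suml; apply: eq_bigr => k _; ring.
have MYY c k : moments P (fun w => Y1 w c 0 * Y2 w k 0 * g w).
  by apply: momentsM => //; exact: momentsM.
have MZZ c k : moments P (fun w => Z w c 0 * Z w k 0) by exact: momentsM.
rewrite (eq_Ex _ L) (eq_Ex _ Rr) !Ex_sum; first last.
- by move=> c; apply: moments_sum => k; exact: momentsM.
- by move=> c; apply: moments_sum => k; exact: momentsZ.
apply: eq_bigr => c _; rewrite !Ex_sum; first last.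
- by move=> k; exact: momentsM.
- by move=> k; exact: momentsZ.
apply: eq_bigr => k _; rewrite ExZ// (Ex_indep ind) ?(Ex_gvec2 _ _ Ss gZ)//.
  exact: gmeasM.
by apply: gmeasM => //; exact: gmeasM.
Qed.

(** The same device for the n-th power of a form: Z is integrated with Y
    frozen. The n-th power is expanded into monomials, indexed by the functions
    from the n factors to the coordinates. *)
Lemma Ex_decouple_pow G1 G2 Z Y n (Q : 'cV[R]_p -> R) :
  independent2 P <<s G1 >> <<s G2 >> ->
  gvmeas G1 Z -> gvmeas G2 Y -> vmoments Z -> vmoments Y ->
  (forall y, Ex P (fun w => ip y (Z w) ^+ n) = Q y) ->
  Ex P (fun w => ip (Y w) (Z w) ^+ n) = Ex P (fun w => Q (Y w)).
Proof.
move=> ind mZ mY MZ MY EQ.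
have pw y z : ip y z ^+ n = \sum_(f : {ffun 'I_n -> 'I_p})
    (\prod_k z (f k) 0) * (\prod_k y (f k) 0).
  rewrite ipE -[in LHS](card_ord n) -prodr_const bigA_distr_bigA /=.
  apply: eq_bigr => f _; rewrite -big_split /=.
  by apply: eq_bigr => k _; rewrite mulrC.
have MpZ (f : {ffun 'I_n -> 'I_p}) : moments P (fun w => \prod_k Z w (f k) 0).
  by apply: moments_prod.
have MpY (f : {ffun 'I_n -> 'I_p}) : moments P (fun w => \prod_k Y w (f k) 0).
  by apply: moments_prod.
have QE y : Q y = \sum_(f : {ffun 'I_n -> 'I_p})
    Ex P (fun w => \prod_k Z w (f k) 0) * (\prod_k y (f k) 0).
  rewrite -EQ; under [X in Ex P X]eq_fun do rewrite pw.
  rewrite Ex_sum; last by move=> f; apply: momentsM => //; exact: moments_cst.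
  apply: eq_bigr => f _.
  by under [X in Ex P X]eq_fun do rewrite mulrC; rewrite ExZ// mulrC.
under [X in Ex P X = _]eq_fun do rewrite pw.
under [X in _ = Ex P X]eq_fun do rewrite QE.
rewrite !Ex_sum; first last.
- by move=> f; exact: momentsM.
- by move=> f; exact: momentsZ.
apply: eq_bigr => f _; rewrite ExZ// (Ex_indep ind)//.
  exact: gmeas_prod.
exact: gmeas_prod.
Qed.

Section moment_bounds.
Variables (S : 'M[R]_p) (pS : posdef S).

Let psdS : psd S.
Proof.
split; first exact: pS.1.
move=> u; have [->|u0] := eqVneq u 0; last exact/ltW/pS.2.
by rewrite /bilin mulmx0 mxE.
Qed.

Let quad_sum G Z M : psd M -> gvec G Z S ->
  exists s : seq 'cV[R]_p,
  [/\ forall b, b \in s -> 0 < bilin b S b,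
      \tr (M *m S) = \sum_(b <- s) bilin b S b &
      forall w, bilin (Z w) M (Z w) = \sum_(b <- s) ip b (Z w) ^+ 2].
Proof.
move=> pM gZ; have [s s0 ->] := psd_sum_outer pM; exists s; split.
- by move=> b /s0; exact: pS.2.
- exact: mxtrace_sum_outer.
- by move=> w; exact: bilin_sum_outer.
Qed.

Lemma Ex_quad2 G Z M : psd M -> gvec G Z S ->
  Ex P (fun w => bilin (Z w) M (Z w) ^+ 2) <= 3 * \tr (M *m S) ^+ 2.
Proof.
move=> pM gZ; have [s [s0 -> qE]] := quad_sum pM gZ.
under [X in Ex P X]eq_fun do rewrite qE.
exact: (Ex_sumsq2 s0 gZ.2).
Qed.

Lemma Ex_quad3 G Z M : psd M -> gvec G Z S ->
  Ex P (fun w => bilin (Z w) M (Z w) ^+ 3) <= 15 * \tr (M *m S) ^+ 3.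
Proof.
move=> pM gZ; have [s [s0 -> qE]] := quad_sum pM gZ.
under [X in Ex P X]eq_fun do rewrite qE.
exact: (Ex_sumsq3 s0 gZ.2).
Qed.

Variables (G1 G2 : set (set T)) (Z1 Z2 : T -> 'cV[R]_p) (A : 'M[R]_p).
Hypotheses (ind : independent2 P <<s G1 >> <<s G2 >>)
  (g1 : gvec G1 Z1 S) (g2 : gvec G2 Z2 S) (As : A^T = A).

Let M1 := gvec_vmoments g1.
Let M2 := gvec_vmoments g2.

Let psdASA : psd (A *m S *m A).
Proof.
split; first by rewrite !trmx_mul As pS.1 mulmxA.
move=> u; have := psdS.2 (A *m u); rewrite -bilin_conj As; exact.
Qed.

Let flip w : bilin (Z1 w) A (Z2 w) = ip (A *m Z2 w) (Z1 w).
Proof. by rewrite bilinC bilin_ip !As. Qed.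

Let decouple n (c : R) m :
  (forall u, Ex P (fun w => ip u (Z1 w) ^+ n) = c * bilin u S u ^+ m) ->
  Ex P (fun w => bilin (Z1 w) A (Z2 w) ^+ n) =
  c * Ex P (fun w => bilin (Z2 w) (A *m S *m A) (Z2 w) ^+ m).
Proof.
move=> h; under [X in Ex P X = _]eq_fun do rewrite flip.
rewrite (Ex_decouple_pow ind g1.1 (gvmeas_mulmx A g2.1) M1
   (vmoments_mulmx A M2) h).
rewrite ExZ; last first.
  by apply/momentsX/moments_bilin; exact: vmoments_mulmx.
congr (_ * _); apply: eq_Ex => w.
by rewrite -bilin_conj As.
Qed.

Lemma Ex_cross4 :
  Ex P (fun w => bilin (Z1 w) A (Z2 w) ^+ 4) <= 9 * \tr (A *m S *m A *m S) ^+ 2.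
Proof.
rewrite (decouple (c := 3) (m := 2)); last by move=> u; exact: gauss_m4 (g1.2 u).
have := Ex_quad2 psdASA g2; lra.
Qed.

Lemma Ex_cross6 :
  Ex P (fun w => bilin (Z1 w) A (Z2 w) ^+ 6) <=
  225 * \tr (A *m S *m A *m S) ^+ 3.
Proof.
rewrite (decouple (c := 15) (m := 3)); last by move=> u; exact: gauss_m6 (g1.2 u).
have := Ex_quad3 psdASA g2; lra.
Qed.

Lemma Ex_cross2 :
  Ex P (fun w => bilin (Z1 w) A (Z2 w) ^+ 2) = \tr (A *m S *m A *m S).
Proof.
rewrite (decouple (c := 1) (m := 1)).
  rewrite mul1r -(Ex_bilin_gvec _ pS.1 g2).
  by apply: eq_Ex => w; rewrite expr1.
by move=> u; rewrite mul1r expr1; exact: gauss_m2 (g1.2 u).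
Qed.

End moment_bounds.

(** Z1 is integrated out first, with (Z2, Z3) frozen, then Z2 with Z3 frozen;
    the remaining quadratic form in Z3 has the trace as its mean. *)
Lemma Ex_cycle3 S A G1 G2 G3 G23 Z1 Z2 Z3 : S^T = S -> A^T = A ->
  independent2 P <<s G1 >> <<s G23 >> -> independent2 P <<s G2 >> <<s G3 >> ->
  G2 `<=` <<s G23 >> -> G3 `<=` <<s G23 >> ->
  gvec G1 Z1 S -> gvec G2 Z2 S -> gvec G3 Z3 S ->
  Ex P (fun w => bilin (Z1 w) A (Z2 w) * bilin (Z2 w) A (Z3 w) *
                 bilin (Z3 w) A (Z1 w)) =
  \tr (A *m S *m (A *m S) *m (A *m S)).
Proof.
move=> Ss As i1 i2 s2 s3 g1 g2 g3.
have M1 := gvec_vmoments g1; have M2 := gvec_vmoments g2.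
have M3 := gvec_vmoments g3.
have m2 : gvmeas G23 Z2 by move=> c; exact: gmeasS s2 (g2.1 c).
have m3 : gvmeas G23 Z3 by move=> c; exact: gmeasS s3 (g3.1 c).
have fl u v : bilin u A v = ip (A *m u) v by rewrite bilin_ip As.
have fl' u v : bilin u A v = ip (A *m v) u by rewrite bilinC As fl.
transitivity (Ex P (fun w => ip (A *m Z2 w) (Z1 w) * ip (A *m Z3 w) (Z1 w) *
    bilin (Z2 w) A (Z3 w))).
  by apply: eq_Ex => w; rewrite fl' (fl (Z3 w)) mulrAC.
rewrite (Ex_decouple_bilin i1 Ss g1); [|exact: gvmeas_mulmx|exact: gvmeas_mulmx|
  exact: gmeas_bilin|exact: vmoments_mulmx|exact: vmoments_mulmx|
  exact: moments_bilin].
transitivity (Ex P (fun w => ip (A *m S *m A *m Z3 w) (Z2 w) *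
    ip (A *m Z3 w) (Z2 w) * 1)).
  apply: eq_Ex => w; rewrite mulr1 [bilin (Z2 w) A (Z3 w)]fl'; congr (_ * _).
  by rewrite bilinC Ss bilin_ip Ss /ip !trmx_mul As Ss !mulmxA.
rewrite (Ex_decouple_bilin i2 Ss g2); [|exact: (gvmeas_mulmx _ g3.1)|exact: (gvmeas_mulmx _ g3.1)|
  exact: gmeas_cst|exact: vmoments_mulmx|exact: vmoments_mulmx|
  exact: moments_cst].
transitivity (Ex P (fun w => bilin (Z3 w) (A *m S *m A *m S *m A) (Z3 w))).
  apply: eq_Ex => w; rewrite mulr1.
  by rewrite /bilin !trmx_mul As Ss !mulmxA.
by rewrite (Ex_bilin_gvec _ Ss g3) !mulmxA.
Qed.

End gauss_vectors.

(** * U-statistics *)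

Section tuple_sums.
Context (R : nmodType) (I : finType).

Lemma big_tuple0 (F : 0.-tuple I -> R) : \sum_t F t = F [tuple].
Proof.
rewrite (bigD1 [tuple])//= big1 ?addr0// => t /negP[].
by apply/eqP; rewrite tuple0; apply/val_inj.
Qed.

Lemma big_tupleS k (F : k.+1.-tuple I -> R) :
  \sum_t F t = \sum_(x : I) \sum_(t : k.-tuple I) F [tuple of x :: t].
Proof.
rewrite pair_big /=.
rewrite (reindex (fun p : I * k.-tuple I => [tuple of p.1 :: p.2]))//=.
exists (fun t => (thead t, [tuple of behead t])) => [[x t]|t] _ /=.
  by congr (_, _); apply/val_inj.
by rewrite -tuple_eta.
Qed.

End tuple_sums.

Section counting.
Local Open Scope nat_scope.

Lemma sum_tuple_mem n k (a : 'I_n) :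
  \sum_(t : k.-tuple 'I_n) (a \in t : nat) <= k * n ^ k.-1.
Proof.
elim: k => [|k IH]; first by rewrite (big_tuple0 (R := nat)).
rewrite (big_tupleS (R := nat)) /=.
apply: (@leq_trans (\sum_(x : 'I_n) (\sum_(t : k.-tuple 'I_n) (x == a : nat) +
                            \sum_(t : k.-tuple 'I_n) (a \in t : nat)))).
  apply: leq_sum => x _; rewrite -big_split /=; apply: leq_sum => t _.
  by rewrite inE eq_sym; case: (x == a); case: (a \in t).
rewrite big_split /= mulSn leq_add//.
  under eq_bigr do rewrite sum_nat_const.
  rewrite -big_distrr /= (bigD1 a)//= eqxx big1 ?addn0 ?muln1.
    by rewrite card_tuple card_ord.
  by move=> x /negbTE ->.
rewrite sum_nat_const card_ord; apply: leq_trans (leq_mul (leqnn n) IH) _.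
by case: k {IH} => [|k] /=; rewrite ?muln0// mulnCA -expnS.
Qed.

(** Tuples that share an entry with t are counted with multiplicity, once per
    entry of t and per position where it reappears. *)
Lemma sum_tuple_meet n k (t : k.-tuple 'I_n) :
  \sum_(t' : k.-tuple 'I_n) (has (mem t) t' : nat) <= k * (k * n ^ k.-1).
Proof.
apply: (@leq_trans (\sum_(t' : k.-tuple 'I_n) \sum_(a <- t) (a \in t' : nat))).
  apply: leq_sum => t' _; case: hasP => // -[a at' ta].
  by rewrite (big_rem a)//= at'.
rewrite exchange_big /= big_tuple.
apply: (@leq_trans (\sum_(i < k) k * n ^ k.-1)).
  by apply: leq_sum => i _; exact: sum_tuple_mem.
by rewrite sum_nat_const card_ord.
Qed.

Lemma sum_tuple_uniq n k : \sum_(t : k.-tuple 'I_n) (uniq t : nat) = n ^_ k.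
Proof.
have := card_uniq_tuples k (@predT 'I_n).
rewrite [in RHS](_ : #|predT| = n); last by rewrite -[RHS](card_ord n); exact: eq_card.
move=> <-; rewrite -sum1_card [RHS]big_mkcond /=; apply: eq_bigr => t _.
by rewrite finset.inE all_predT /=; case: uniq.
Qed.

(** Factor by factor: n <= k (n - i) for i < k <= n. *)
Lemma expn_le_ffact n k : k <= n -> n ^ k <= k ^ k * n ^_ k.
Proof.
move=> kn; rewrite ffact_prod -{1 3}(card_ord k) -!prod_nat_const -big_split /=.
apply: leq_prod => i _.
have := ltn_ord i; nia.
Qed.

End counting.

Section ustat.
Context (R : realType) (d : measure_display) (T : measurableType d)
  (P : probability T R) (n k : nat).
Variables (h : k.-tuple 'I_n -> T -> R) (theta K : R).
Hypothesis kn : (k <= n)%N.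
Hypothesis Mh : forall t, moments P (h t).
Hypothesis Eh : forall t : k.-tuple 'I_n, uniq t -> Ex P (h t) = theta.
Hypothesis Kh : forall t : k.-tuple 'I_n, uniq t -> Ex P (fun w => h t w ^+ 2) <= K.
Hypothesis ch : forall t t' : k.-tuple 'I_n, uniq t -> uniq t' -> ~~ has (mem t) t' ->
  Ex P (fun w => h t w * h t' w) = Ex P (h t) * Ex P (h t').

Definition ustat w := (n ^_ k)%:R^-1 * \sum_(t : k.-tuple 'I_n | uniq t) h t w.

Lemma ustat_moments : moments P ustat.
Proof. by apply: momentsZ; apply: moments_sum. Qed.

Let nk0 : (0 : R) < (n ^_ k)%:R.
Proof. by rewrite ltr0n ffact_gt0. Qed.

Let sum_uniq (c : R) : \sum_(t : k.-tuple 'I_n | uniq t) c = (n ^_ k)%:R * c.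
Proof.
rewrite -sum_tuple_uniq natr_sum mulr_suml big_mkcond /=.
by apply: eq_bigr => t _; case: (uniq t); rewrite ?mul1r ?mul0r.
Qed.

Lemma Ex_ustat : Ex P ustat = theta.
Proof.
rewrite ExZ; last exact: moments_sum.
rewrite Ex_sum// (eq_bigr (fun=> theta))// sum_uniq mulKf//.
by rewrite gt_eqF.
Qed.

Let hc t w := h t w - theta.

Let Mhc t : moments P (hc t).
Proof. by apply: momentsB => //; exact: moments_cst. Qed.

Let Ehc2 (t : k.-tuple 'I_n) : uniq t -> Ex P (fun w => hc t w ^+ 2) <= K.
Proof.
move=> ut; apply: le_trans (Kh ut).
have -> : Ex P (fun w => hc t w ^+ 2) = Ex P (fun w => h t w ^+ 2) - theta ^+ 2.
  transitivity (Ex P (fun w => h t w ^+ 2 - (2 * theta) * h t w + theta ^+ 2)).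
    by apply: eq_Ex => w; rewrite /hc; ring.
  have M2 := momentsX 2 (Mh t); have MZ := momentsZ (2 * theta) (Mh t).
  rewrite ExD ?ExB ?(ExZ _ (Mh t)) ?Eh//; last 2 first.
  - exact: momentsB.
  - exact: moments_cst.
  by rewrite (Ex_cst P (theta ^+ 2)); ring.
by rewrite gerBl sqr_ge0.
Qed.

Let Ehc_prod (t t' : k.-tuple 'I_n) : uniq t -> uniq t' ->
  Ex P (fun w => hc t w * hc t' w) <= (has (mem t) t')%:R * K.
Proof.
move=> ut ut'; case: (boolP (has _ _)) => hh; rewrite ?mul1r ?mul0r.
  have le w : hc t w * hc t' w <= 2^-1 * (hc t w ^+ 2 + hc t' w ^+ 2).
    have := sqr_ge0 (hc t w - hc t' w); rewrite sqrrB; lra.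
  have M2 s := momentsX 2 (Mhc s).
  apply: le_trans (le_Ex _ _ le) _; first exact: momentsM.
    by apply/momentsZ/momentsD.
  rewrite ExZ ?ExD//; last exact: momentsD.
  have := Ehc2 ut; have := Ehc2 ut'; lra.
have -> : Ex P (fun w => hc t w * hc t' w) = Ex P (fun w => h t w * h t' w -
    theta * h t w - theta * h t' w + theta ^+ 2).
  by apply/eq_Ex => w; rewrite /hc; ring.
have M1 := momentsM (Mh t) (Mh t').
have MZ s := momentsZ theta (Mh s).
rewrite ExD ?ExB ?(ExZ _ (Mh _)) ?ch ?Eh//; last 3 first.
- exact: momentsB.
- by apply: momentsB => //; exact: momentsB.
- exact: moments_cst.
by rewrite (Ex_cst P (theta ^+ 2)) le_eqVlt; apply/orP; left; apply/eqP; ring.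
Qed.

Definition ustat_factor : R := (k * k * k ^ k)%:R.

(** Expanding the square leaves at most k^2 n^(k-1) nonzero covariances for
    each of the n^_k tuples, each at most K since x y <= (x^2 + y^2) / 2;
    the number of tuples is at least (n/k)^k. *)
Lemma ustat_var : (0 < k)%N -> 0 <= K ->
  Ex P (fun w => (ustat w - theta) ^+ 2) <= ustat_factor * K / n%:R.
Proof.
move=> k0 K0.
have n0 : (0 : R) < n%:R by rewrite ltr0n (leq_trans k0).
have E w : (ustat w - theta) ^+ 2 = (n ^_ k)%:R^-1 ^+ 2 *
    \sum_(t : k.-tuple 'I_n | uniq t) \sum_(t' : k.-tuple 'I_n | uniq t')
      hc t w * hc t' w.
  under eq_bigr do rewrite -mulr_sumr.
  rewrite -mulr_suml sumrB sum_uniq /ustat.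
  by field; rewrite gt_eqF.
rewrite (eq_Ex _ E) ExZ; last first.
  by apply: moments_sum => t; apply: moments_sum => t'; exact: momentsM.
rewrite Ex_sum; last by move=> t; apply: moments_sum => t'; exact: momentsM.
have le1 : \sum_(t : k.-tuple 'I_n | uniq t)
    Ex P (fun w => \sum_(t' : k.-tuple 'I_n | uniq t') hc t w * hc t' w) <=
    (n ^_ k)%:R * ((k * (k * n ^ k.-1))%:R * K).
  rewrite -sum_uniq; apply: ler_sum => t ut.
  rewrite Ex_sum; last by move=> t'; exact: momentsM.
  apply: (@le_trans _ _ (\sum_(t' : k.-tuple 'I_n) (has (mem t) t')%:R * K)).
    rewrite big_mkcond; apply: ler_sum => t' _; case: ifP => ut'.
      exact: Ehc_prod.
    by rewrite mulr_ge0.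
  rewrite -mulr_suml ler_wpM2r// -natr_sum ler_nat; exact: sum_tuple_meet.
apply: le_trans (ler_wpM2l _ le1) _; first by rewrite exprn_ge0 ?invr_ge0 ?ltW.
have le2 : (n ^ k)%:R <= (k ^ k)%:R * (n ^_ k)%:R :> R.
  by rewrite -natrM ler_nat expn_le_ffact.
have -> : (n ^_ k)%:R^-1 ^+ 2 * ((n ^_ k)%:R * ((k * (k * n ^ k.-1))%:R * K)) =
   (k * k)%:R * K * ((n ^ k)%:R / (n ^_ k)%:R / n%:R).
  rewrite -[in RHS](prednK k0) expnS prednK// !natrM.
  by field; rewrite !gt_eqF.
have -> : ustat_factor * K / n%:R = (k * k)%:R * K * ((k ^ k)%:R / n%:R).
  by rewrite /ustat_factor !natrM; ring.
rewrite ler_wpM2l ?mulr_ge0//.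
by rewrite ler_pM2r ?invr_gt0// ler_pdivrMr.
Qed.

End ustat.

(** * The differences for fixed permutations *)

Section gauss_sum.
Context (R : realType) (d : measure_display) (T : measurableType d)
  (P : probability T R) (I : finType) (F : I -> set (set T)).
Hypothesis Fsig : forall i, sigma_algebra setT (F i).
Hypothesis Fm : forall i, F i `<=` measurable.
Hypothesis Find : mutually_independent P F.

Lemma gmeas_gen A B (f : T -> R) : A `<=` B -> gmeas (gen_of F A) f -> gmeas (gen_of F B) f.
Proof.
move=> AB; apply: gmeasS => X [i Ai FX]; apply: sub_sigma_algebra.
by exists i => //; exact: AB.
Qed.

Lemma gauss_sum (J : eqType) (s : seq J) (A : J -> set I) (f : J -> T -> R)
    (v : J -> R) : uniq s ->
  (forall j k, j != k -> A j `&` A k = set0) ->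
  (forall j, gmeas (gen_of F (A j)) (f j)) ->
  (forall j, gauss P (f j) (v j)) ->
  gauss P (fun w => \sum_(j <- s) f j w) (\sum_(j <- s) v j).
Proof.
move=> us dA mf gf.
elim: s us => [|j s IH] /=.
  move=> _; rewrite big_nil; under eq_fun do rewrite big_nil.
  exact: gauss0.
move=> /andP[js us]; rewrite big_cons; under eq_fun do rewrite big_cons.
apply: (gaussD (G1 := gen_of F (A j)) (G2 := gen_of F (\bigcup_(k in [set` s]) A k))) => //.
- apply: (block_independent Fsig Fm Find); rewrite setI_bigcupr bigcup0// => k /= ks.
  by apply: dA; apply: contraNneq js => ->.
- under [X in gmeas _ X]eq_fun do rewrite big_seq.
  apply: gmeas_sum => k ks; apply: gmeas_gen (mf k).
  by apply: bigcup_sup.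
- exact: IH.
Qed.

End gauss_sum.

Section model_vectors.
Context (R : realType) (m : model R).
Local Notation P := (prob m).
Local Notation n := (nmin m).

Definition obsix := {i : 'I_(ngroups m) & 'I_(nobs i)}.
Definition obsalg (ij : obsix) : set (set (Omega m)) := sigma_vec (obs (tagged ij)).
(** A value of all the permutations of one repetition. *)
Definition plan := {dffun forall i : 'I_(ngroups m), {perm 'I_(nobs i)}}.
Definition plan_obs (s : plan) (l : 'I_n) (i : 'I_(ngroups m)) : obsix :=
  Tagged (fun i => 'I_(nobs i)) (s i (widen_ord (nmin_le i) l)).
Definition plan_block (s : plan) (L : pred 'I_n) : set obsix :=
  [set ij | exists l i, L l /\ ij = plan_obs s l i].

Lemma plan_obs_inj s l l' i i' : plan_obs s l i = plan_obs s l' i' -> l = l' /\ i = i'.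
Proof.
move=> e; have ii : i = i' by have := congr1 tag e.
subst i'; split=> //.
move/eqP: e; rewrite /plan_obs eq_Tagged => /eqP /perm_inj e.
by apply/val_inj; have := congr1 val e.
Qed.

Lemma plan_block_disjoint s (L L' : pred 'I_n) : (forall l, L l -> ~~ L' l) ->
  plan_block s L `&` plan_block s L' = set0.
Proof.
move=> LL; apply/seteqP; split => // ij [[l [i [Ll ->]]] [l' [i' [Ll' e]]]].
by have [e1 _] := plan_obs_inj e; have := LL _ Ll; rewrite e1 Ll'.
Qed.

Lemma plan_blockS s (L L' : pred 'I_n) : (forall l, L l -> L' l) -> plan_block s L `<=` plan_block s L'.
Proof. by move=> LL ij [l [i [Ll ->]]]; exists l, i; split => //; exact: LL. Qed.

Lemma obsalg_sigma ij : sigma_algebra setT (obsalg ij).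
Proof. exact: smallest_sigma_algebra. Qed.

Lemma obsalg_coord ij c (A : set R) : measurable A ->
  obsalg ij (vec_coord (obs (tagged ij)) c @^-1` A).
Proof.
move=> mA; apply: sub_sigma_algebra; rewrite -bigcup_seq /=.
by exists c => /=; [rewrite mem_index_enum|exists A => //; rewrite setTI].
Qed.

Lemma obsalg_meas ij : obsalg ij `<=` measurable.
Proof.
apply: smallest_sub; first exact: sigma_algebra_measurable.
rewrite -bigcup_seq => X [c _ [A mA <-]].
have [mX _] := obs_normal (tagged ij).
exact: (mX c).
Qed.

Lemma obs_meas ij c : gmeas (gen_of obsalg [set ij]) (fun w => obs (tagged ij) w c 0).
Proof.
move=> _ A mA; rewrite setTI; apply: sub_sigma_algebra.
by exists ij => //; exact: obsalg_coord.
Qed.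

(** The null form is treated apart: its law is degenerate, so the normal law
    of the model does not cover it. *)
Lemma gauss_obs (ij : obsix) u :
  gauss P (fun w => ip u (obs (tagged ij) w) - ip u (mean (tag ij)))
    (bilin u (cov (tag ij)) u).
Proof.
have [u0|u0] := eqVneq u 0.
  rewrite u0 /bilin mulmx0 mxE.
  rewrite (_ : (fun w => _) = fun=> 0); first exact: gauss0.
  by apply/funext => w; rewrite /ip trmx0 !mul0mx mxE subrr.
have [mX nX] := obs_normal (tagged ij).
have b0 : 0 < bilin u (cov (tag ij)) u by have [_] := cov_posdef (tag ij); apply.
rewrite -[X in gauss _ _ X]sqr_sqrtr; last exact: ltW.
apply: gauss_normal.
- by rewrite gt_eqF// sqrtr_gt0.
- under eq_fun do rewrite ipE.
  apply: measurable_sum => c; apply: measurable_funM => //.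
  exact: mX.
- by move=> A mA; exact: nX.
Qed.

(** The stacked difference [Zdiff] with the permutations frozen at s. *)
Definition Zplan (s : plan) (l1 l2 : 'I_n) (w : Omega m) :
    'cV[R]_(\sum_(i < ngroups m) Defs.dim i) :=
  \mxcol_(i < ngroups m) (Num.sqrt ((ntot m)%:R / (nobs i)%:R) *:
     (obs (s i (widen_ord (nmin_le i) l1)) w -
      obs (s i (widen_ord (nmin_le i) l2)) w)).

Lemma ip_mxcol (u : 'cV[R]_(\sum_(i < ngroups m) Defs.dim i))
    (z : forall i : 'I_(ngroups m), 'cV[R]_(Defs.dim i)) :
  ip u (\mxcol_i z i) = \sum_i ip (submxcol u i) (z i).
Proof.
rewrite /ip -{1}[u]submxcolK tr_mxcol mul_mxrow_mxcol summxE.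
by [].
Qed.

Lemma bilin_VN u : bilin u (VN m) u = \sum_i
  ((ntot m)%:R / (nobs i)%:R) * bilin (submxcol u i) (cov i) (submxcol u i).
Proof.
rewrite /bilin /VN -{1 2}[u]submxcolK tr_mxcol /mxdiag mul_mxrow_mxblock.
rewrite mul_mxrow_mxcol summxE; apply: eq_bigr => i _.
rewrite (bigD1 i)//= eqxx conform_mx_id big1 ?addr0.
  by rewrite -scalemxAr -scalemxAl mxE.
by move=> j /negbTE ->; rewrite mulmx0.
Qed.

Lemma nobs_natr (i : 'I_(ngroups m)) : (0 : R) < (nobs i)%:R.
Proof. by rewrite ltr0n nobs_gt0. Qed.

Lemma ntot_gt0 : (0 < ntot m)%N.
Proof.
have i0 := Ordinal (ngroups_gt0 m).
by rewrite /ntot (bigD1 i0)//= addn_gt0 nobs_gt0.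
Qed.

Lemma ratio_gt0 (i : 'I_(ngroups m)) : (0 : R) < (ntot m)%:R / (nobs i)%:R.
Proof. by rewrite divr_gt0 ?nobs_natr// ltr0n ntot_gt0. Qed.

Lemma posdef_VN : posdef (VN m).
Proof.
split.
  rewrite /VN tr_mxdiag; apply/eq_mxdiag => i.
  by rewrite linearZ /=; have [-> _] := cov_posdef i.
move=> u u0; rewrite bilin_VN.
have [i ui] : exists i, submxcol u i != 0.
  apply/existsP; apply: contraNT u0 => /existsPn u0.
  by apply/eqP/mxcolP => i; rewrite submxcol0; apply/eqP; rewrite -[_ == _]negbK.
rewrite (bigD1 i)//= ltr_pwDl//.
  by rewrite mulr_gt0 ?ratio_gt0//; have [_] := cov_posdef i; apply.
apply: sumr_ge0 => j _; rewrite mulr_ge0 ?(ltW (ratio_gt0 j))//.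
have [->|uj] := eqVneq (submxcol u j) 0; first by rewrite /bilin mulmx0 mxE.
by apply/ltW; have [_] := cov_posdef j; apply.
Qed.

Lemma obs_ip_meas i (j : 'I_(nobs i)) (u : 'cV_(Defs.dim i)) :
  gmeas (gen_of obsalg [set Tagged (fun i => 'I_(nobs i)) j]) (fun w => ip u (obs j w)).
Proof.
under [X in gmeas _ X]eq_fun do rewrite ipE.
apply: gmeas_sum => c _; apply: gmeasM; first exact: gmeas_cst.
exact: (@obs_meas (Tagged (fun i => 'I_(nobs i)) j) c).
Qed.

Lemma obsalg_indep (A B : set obsix) : A `&` B = set0 ->
  independent2 P <<s gen_of obsalg A >> <<s gen_of obsalg B >>.
Proof.
exact: (block_independent obsalg_sigma obsalg_meas (obs_indep (m := m))).
Qed.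

Lemma ipBr p (u v z : 'cV[R]_p) : ip u (v - z) = ip u v - ip u z.
Proof. by rewrite /ip mulmxBr !mxE. Qed.

Lemma gauss_obs_diff i (j j' : 'I_(nobs i)) u : j != j' ->
  gauss P (fun w => ip u (obs j w - obs j' w)) (2 * bilin u (cov i) u).
Proof.
move=> jj.
have g1 := @gauss_obs (Tagged (fun i => 'I_(nobs i)) j) u.
have g2 := gaussZ (-1) (@gauss_obs (Tagged (fun i => 'I_(nobs i)) j') u).
have m1 k : gmeas (gen_of obsalg [set Tagged (fun i => 'I_(nobs i)) k])
    (fun w => ip u (obs k w) - ip u (mean i)).
  by apply: gmeasB; [exact: obs_ip_meas|exact: gmeas_cst].
have m2 : gmeas (gen_of obsalg [set Tagged (fun i => 'I_(nobs i)) j'])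
    (fun w => -1 * (ip u (obs j' w) - ip u (mean i))).
  by apply: gmeasM (m1 j'); exact: gmeas_cst.
have dis : [set Tagged (fun i => 'I_(nobs i)) j] `&`
           [set Tagged (fun i => 'I_(nobs i)) j'] = set0.
  apply/seteqP; split=> // ij [-> /= /eqP]; rewrite eq_Tagged /= => /eqP e.
  by rewrite e eqxx in jj.
have := gaussD (obsalg_indep dis) (m1 j) m2 g1 g2.
congr (gauss _ _ _); first by apply/funext => w /=; rewrite ipBr; ring.
by rewrite /=; ring.
Qed.

(** A linear form of the stacked difference is a sum over the groups of
    independent terms, in each of which the group mean cancels. Two distinct
    positions are occupied by distinct observations, whence the factor 2. *)
Lemma gvec_Zplan s l1 l2 : l1 != l2 ->
  gvec P (gen_of obsalg (plan_block s (pred2 l1 l2))) (Zplan s l1 l2) (2 *: VN m).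
Proof.
move=> ll.
have dff i (u : 'cV_(Defs.dim i)) (L : pred 'I_n) : L l1 -> L l2 ->
    gmeas (gen_of obsalg [set ij | exists l, L l /\ ij = plan_obs s l i])
    (fun w => ip u (obs (s i (widen_ord (nmin_le i) l1)) w -
                    obs (s i (widen_ord (nmin_le i) l2)) w)).
  move=> L1 L2; under [X in gmeas _ X]eq_fun do rewrite ipBr.
  have sub l : L l -> [set plan_obs s l i] `<=` [set ij | exists l, L l /\ ij = plan_obs s l i].
    by move=> Ll ij /= ->; exists l.
  by apply: gmeasB; [apply: (gmeas_gen (sub l1 L1)) | apply: (gmeas_gen (sub l2 L2))];
    exact: obs_ip_meas.
split.
  move=> c; rewrite (_ : (fun w => _) = fun w => ip (delta_mx c 0) (Zplan s l1 l2 w)); last first.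
    by apply/funext => w; rewrite /ip trmx_delta -rowE [RHS]mxE.
  under [X in gmeas _ X]eq_fun do rewrite ip_mxcol.
  apply: gmeas_sum => i _.
  under [X in gmeas _ X]eq_fun do rewrite /ip -scalemxAr mxE.
  apply: gmeasM; first exact: gmeas_cst.
  apply: (gmeas_gen _ (dff i (submxcol (delta_mx c 0) i) (pred2 l1 l2) _ _)).
  - by move=> _ [l [Ll ->]]; exists l, i.
  - by rewrite /= eqxx.
  - by rewrite /= eqxx orbT.
move=> u; under eq_fun do rewrite ip_mxcol.
rewrite bilinZm bilin_VN mulr_sumr.
apply: (gauss_sum obsalg_sigma obsalg_meas (obs_indep (m := m))
   (A := fun i => [set ij | exists l, pred2 l1 l2 l /\ ij = plan_obs s l i])).
- exact: index_enum_uniq.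
- move=> i k ik; apply/seteqP; split => // ij [[l [_ ->]] [l' [_ e]]].
  by have [_ e2] := plan_obs_inj e; rewrite e2 eqxx in ik.
- move=> i; under [X in gmeas _ X]eq_fun do rewrite /ip -scalemxAr mxE.
  apply: gmeasM; first exact: gmeas_cst.
  by apply: dff; rewrite /= eqxx ?orbT.
- move=> i; under eq_fun do rewrite /ip -scalemxAr mxE.
  have jj : s i (widen_ord (nmin_le i) l1) != s i (widen_ord (nmin_le i) l2).
    apply: contra_neq ll => /perm_inj e.
    by apply/val_inj; have := congr1 val e.
  have := gaussZ (Num.sqrt ((ntot m)%:R / (nobs i)%:R))
    (gauss_obs_diff (submxcol u i) jj).
  congr (gauss _ _ _); rewrite sqr_sqrtr; last exact/ltW/ratio_gt0.
  by ring.
Qed.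
End model_vectors.

(** * Averaging over the random permutations *)

Section shuffle_average.
Context (R : realType) (m : model R).
Local Notation P := (prob m).

Definition shufplan (j : nat) (w : Omega m) : plan m :=
  [ffun i : 'I_(ngroups m) => shuffle j i w].

Definition shufalg : set (set (Omega m)) :=
  \bigcup_(ji in [set: nat * 'I_(ngroups m)]) sigma_fin (shuffle ji.1 ji.2).

(** The indicator of the event that repetition j uses the permutations s, as
    a product so that its measurability is visible. *)
Definition plan_ind (j : nat) (s : plan m) (w : Omega m) : R :=
  \prod_(i : 'I_(ngroups m)) \1_(shuffle j i @^-1` [set s i]) w.

Lemma plan_indE j s w : plan_ind j s w = (shufplan j w == s)%:R.
Proof.
rewrite /plan_ind; case: eqP => [<-|ne].
  by rewrite big1// => i _; rewrite indicE mem_set//= ffunE.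
have [i si] : exists i, shuffle j i w != s i.
  apply/existsP; apply: contra_notT ne => /existsPn h.
  by apply/ffunP => i; rewrite ffunE; apply/eqP; rewrite -[_ == _]negbK.
rewrite (bigD1 i)//= indicE memNset ?mul0r//=.
exact/eqP.
Qed.

Lemma plan_ind_gmeas j s : gmeas shufalg (plan_ind j s).
Proof.
apply: gmeas_prod => i _; apply: measurable_indic.
apply: sub_sigma_algebra; exists (j, i) => //=.
by exists [set s i] => //; rewrite setTI.
Qed.

Lemma plan_ind_moments j s : moments P (plan_ind j s).
Proof.
apply: moments_prod => i; split.
  exact/measurable_indic/shuffle_meas.
move=> p; apply: (le_integrable measurableT _ _
    (finite_measure_integrable_cst P 1 measurableT)).
  apply/measurable_EFinP/measurable_funX/measurableT_comp => //.
  exact/measurable_indic/shuffle_meas.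
move=> w _ /=; rewrite lee_fin normr1 normrX normr_id exprn_ile1//.
by rewrite indicE; case: (_ \in _); rewrite ?normr1 ?normr0.
Qed.

Variable S : plan m -> Omega m -> R.
Hypothesis Sg : forall s, gmeas (gen_of (@obsalg R m) setT) (S s).
Hypothesis SM : forall s, moments P (S s).

(** A statistic evaluated at random permutations is a finite mixture of its
    values at fixed ones. *)
Lemma shuffledE j w :
  S (shufplan j w) w = \sum_(s : plan m) plan_ind j s w * S s w.
Proof.
rewrite (bigD1 (shufplan j w))//= plan_indE eqxx mul1r big1 ?addr0// => s ns.
by rewrite plan_indE eq_sym (negbTE ns) mul0r.
Qed.

Lemma shuffled_moments j : moments P (fun w => S (shufplan j w) w).
Proof.
under eq_fun do rewrite shuffledE.
by apply: moments_sum => s; apply: momentsM => //; exact: plan_ind_moments.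
Qed.

Lemma Ex_shuffled j : Ex P (fun w => S (shufplan j w) w) =
  \sum_(s : plan m) Ex P (plan_ind j s) * Ex P (S s).
Proof.
rewrite (eq_Ex _ (shuffledE j)) Ex_sum; last first.
  by move=> s; apply: momentsM => //; exact: plan_ind_moments.
apply: eq_bigr => s _.
exact: (Ex_indep (shuffle_obs_indep (m := m)) (plan_ind_gmeas _ _) (Sg s)
  (plan_ind_moments _ _) (SM s)).
Qed.

End shuffle_average.

Section plan_weights.
Context (R : realType) (m : model R).
Local Notation P := (prob m).

Lemma sum_plan_ind j : \sum_(s : plan m) Ex P (plan_ind j s) = 1.
Proof.
rewrite -Ex_sum; last by move=> s; exact: plan_ind_moments.
rewrite -[RHS](Ex_cst P); apply: eq_Ex => w.
transitivity (\sum_(s : plan m) plan_ind j s w * 1).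
  by apply: eq_bigr => s _; rewrite mulr1.
by rewrite -(shuffledE (fun=> fun=> 1) j w).
Qed.

Lemma sqr_mean_le U (x : nat -> R) : (0 < U)%N ->
  (U%:R^-1 * \sum_(j < U) x j) ^+ 2 <= U%:R^-1 * \sum_(j < U) x j ^+ 2.
Proof.
move=> U0; have U0' : (0 : R) < U%:R by rewrite ltr0n.
set a := _ * _.
have Ea : \sum_(j < U) x j = U%:R * a by rewrite /a mulVKf// gt_eqF.
have : 0 <= \sum_(j < U) (x j - a) ^+ 2 by apply: sumr_ge0 => j _; exact: sqr_ge0.
have -> : \sum_(j < U) (x j - a) ^+ 2 = \sum_(j < U) x j ^+ 2 - U%:R * a ^+ 2.
  transitivity (\sum_(j < U) (x j ^+ 2 - (2 * a) * x j + a ^+ 2)).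
    by apply: eq_bigr => j _; ring.
  rewrite big_split /= sumrB -mulr_sumr Ea sumr_const card_ord -mulr_natl.
  by ring.
by rewrite subr_ge0 => h; rewrite ler_pdivlMl.
Qed.

(** The mean and the mean squared deviation from theta are mixtures of the
    values at fixed permutations, with the same weights, which sum to 1. The
    average over the repetitions is controlled by the convexity of the square. *)
Lemma average_shuffled (S : plan m -> Omega m -> R) U theta V : (0 < U)%N ->
  (forall s, gmeas (gen_of (@obsalg R m) setT) (S s)) ->
  (forall s, moments P (S s)) ->
  (forall s, Ex P (S s) = theta) ->
  (forall s, Ex P (fun w => (S s w - theta) ^+ 2) <= V) ->
  let B w := U%:R^-1 * \sum_(j < U) S (shufplan j w) w in
  [/\ moments P B, Ex P B = theta & Ex P (fun w => (B w - theta) ^+ 2) <= V].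
Proof.
move=> U0 Sg SM ES VS B.
have U0' : (0 : R) < U%:R by rewrite ltr0n.
have MY j := shuffled_moments SM j.
have MB : moments P B by apply: momentsZ; apply: moments_sum => j; exact: MY.
split => //.
  rewrite ExZ; last by apply: moments_sum => j; exact: MY.
  rewrite Ex_sum; last by move=> j; exact: MY.
  rewrite (eq_bigr (fun=> theta)); last first.
    move=> j _; rewrite Ex_shuffled// (eq_bigr (fun s => Ex P (plan_ind j s) * theta)).
      by rewrite -mulr_suml sum_plan_ind mul1r.
    by move=> s _; rewrite ES.
  by rewrite sumr_const card_ord -[theta *+ U]mulr_natl mulKf// gt_eqF.
pose S2 s w := (S s w - theta) ^+ 2.
have S2g s : gmeas (gen_of (@obsalg R m) setT) (S2 s).
  by apply: gmeasX; apply: gmeasB; [exact: Sg|exact: gmeas_cst].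
have S2M s : moments P (S2 s).
  by apply/momentsX/momentsB => //; exact: moments_cst.
have MY2 j := shuffled_moments S2M j.
apply: (@le_trans _ _ (Ex P (fun w => U%:R^-1 * \sum_(j < U) S2 (shufplan j w) w))).
  apply: le_Ex.
  - by apply/momentsX/momentsB => //; exact: moments_cst.
  - by apply: momentsZ; apply: moments_sum => j; exact: MY2.
  move=> w; rewrite /S2.
  have -> : B w - theta = U%:R^-1 * \sum_(j < U) (S (shufplan j w) w - theta).
    rewrite sumrB mulrBr sumr_const card_ord -[theta *+ U]mulr_natl mulKf//.
    by rewrite gt_eqF.
  exact: (sqr_mean_le (fun j => S (shufplan j w) w - theta)).
rewrite ExZ; last by apply: moments_sum => j; exact: MY2.
rewrite Ex_sum; last by move=> j; exact: MY2.
rewrite ler_pdivrMl//.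
apply: (@le_trans _ _ (\sum_(j < U) V)).
  apply: ler_sum => j _; rewrite Ex_shuffled//.
  apply: (@le_trans _ _ (\sum_(s : plan m) Ex P (plan_ind j s) * V)).
    apply: ler_sum => s _; rewrite ler_wpM2l//; last exact: VS.
    by apply: Ex_ge0 => w; rewrite plan_indE.
  by rewrite -mulr_suml sum_plan_ind mul1r.
by rewrite sumr_const card_ord -[V *+ U]mulr_natl.
Qed.

End plan_weights.

(** * The three kernels *)

Lemma sqr_prod3_le (R : realFieldType) (x y z : R) :
  (8^-1 * (x * y * z)) ^+ 2 <= 192^-1 * (x ^+ 6 + y ^+ 6 + z ^+ 6).
Proof.
have h := amgm3 (sqr_ge0 x) (sqr_ge0 y) (sqr_ge0 z).
have e6 (a : R) : (a ^+ 2) ^+ 3 = a ^+ 6 by rewrite -exprM.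
rewrite !e6 in h.
have -> : (8^-1 * (x * y * z)) ^+ 2 = 192^-1 * (3 * (x ^+ 2 * y ^+ 2 * z ^+ 2)).
  by field.
by rewrite ler_pM2l// invr_gt0 ltr0n.
Qed.

Section kernels.
Context (R : realType) (m : model R).
Local Notation P := (prob m).
Local Notation n := (nmin m).
Local Notation A := (projT m).
Local Notation V := (VN m).
Local Notation tau k := (\tr (TV m ^+ k)).
Local Notation o2 i := (@Ordinal 2 i isT).
Local Notation o4 i := (@Ordinal 4 i isT).
Local Notation o6 i := (@Ordinal 6 i isT).

Definition Zform (s : plan m) (l1 l2 l3 l4 : 'I_n) (w : Omega m) : R :=
  bilin (Zplan s l1 l2 w) A (Zplan s l3 l4 w).

Definition kernel1 (s : plan m) (t : 2.-tuple 'I_n) w : R :=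
  2^-1 * Zform s (tnth t (o2 0)) (tnth t (o2 1)) (tnth t (o2 0)) (tnth t (o2 1)) w.

Definition kernel2 (s : plan m) (t : 4.-tuple 'I_n) w : R :=
  4^-1 * Zform s (tnth t (o4 0)) (tnth t (o4 1)) (tnth t (o4 2)) (tnth t (o4 3)) w ^+ 2.

Definition kernel3 (s : plan m) (t : 6.-tuple 'I_n) w : R :=
  8^-1 * (Zform s (tnth t (o6 0)) (tnth t (o6 1)) (tnth t (o6 2)) (tnth t (o6 3)) w *
          Zform s (tnth t (o6 2)) (tnth t (o6 3)) (tnth t (o6 4)) (tnth t (o6 5)) w *
          Zform s (tnth t (o6 4)) (tnth t (o6 5)) (tnth t (o6 0)) (tnth t (o6 1)) w).

Lemma Zplan_vmoments s l1 l2 : vmoments P (Zplan s l1 l2).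
Proof.
have [->|ll] := eqVneq l1 l2; last exact: gvec_vmoments (gvec_Zplan s ll).
move=> c; rewrite (_ : (fun w => _) = fun=> 0); first exact: moments_cst.
by apply/funext => w; rewrite !mxE subrr mulr0.
Qed.

Lemma Zform_moments s l1 l2 l3 l4 : moments P (Zform s l1 l2 l3 l4).
Proof. by apply: moments_bilin; exact: Zplan_vmoments. Qed.

Lemma tnth_neq k (t : k.-tuple 'I_n) (i j : 'I_k) : uniq t -> i != j ->
  tnth t i != tnth t j.
Proof. by move=> /tuple_uniqP inj; apply: contra_neq => /inj. Qed.

Lemma Zplan_gvmeas s k (t : k.-tuple 'I_n) i j : uniq t -> i != j ->
  gvmeas (gen_of (@obsalg R m) (plan_block s (mem t))) (Zplan s (tnth t i) (tnth t j)).
Proof.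
move=> ut ij c; have [g _] := gvec_Zplan s (tnth_neq ut ij).
apply: gmeas_gen (g c); apply: plan_blockS => l /= /pred2P[]->; exact: mem_tnth.
Qed.

Lemma Zform_gmeas s k (t : k.-tuple 'I_n) i j i' j' : uniq t ->
  i != j -> i' != j' ->
  gmeas (gen_of (@obsalg R m) (plan_block s (mem t)))
    (Zform s (tnth t i) (tnth t j) (tnth t i') (tnth t j')).
Proof. by move=> ut ij ij'; apply: gmeas_bilin; exact: Zplan_gvmeas. Qed.

Lemma Zplan_indep s (L1 L2 : pred 'I_n) : (forall l, L1 l -> ~~ L2 l) ->
  independent2 P <<s gen_of (@obsalg R m) (plan_block s L1) >>
                 <<s gen_of (@obsalg R m) (plan_block s L2) >>.
Proof. by move=> L; apply: obsalg_indep; exact: plan_block_disjoint. Qed.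

Lemma posdef2V : posdef (2 *: V).
Proof.
have [Vs V0] := posdef_VN m; split; first by rewrite linearZ /= Vs.
by move=> u u0; rewrite bilinZm mulr_gt0// V0.
Qed.

Lemma psd_projT : psd A.
Proof.
split; first exact: projT_sym.
move=> u; have -> : bilin u A u = ip (A *m u) (A *m u).
  by rewrite /bilin /ip trmx_mul projT_sym !mulmxA -(mulmxA _ A A) projT_idem.
by rewrite ipE sumr_ge0// => c _; rewrite -expr2 sqr_ge0.
Qed.

Lemma tr_T2V : \tr (A *m (2 *: V)) = 2 * \tr (TV m).
Proof. by rewrite -scalemxAr linearZ. Qed.

Lemma tr_T2V_sq : \tr (A *m (2 *: V) *m A *m (2 *: V)) = 4 * tau 2.
Proof.
rewrite expr2 -[TV m * TV m]/(TV m *m TV m) /TV.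
rewrite -?scalemxAr -?scalemxAl -?scalemxAr -?scalemxAl !mulmxA !linearZ /= mulrA.
by congr (_ * _); ring.
Qed.

Lemma tr_T2V_cube : \tr (A *m (2 *: V) *m (A *m (2 *: V)) *m (A *m (2 *: V))) = 8 * tau 3.
Proof.
rewrite exprS expr2 -[TV m * (TV m * TV m)]/(TV m *m (TV m *m TV m)) /TV.
do 4!rewrite -?scalemxAr -?scalemxAl.
rewrite !mulmxA.
rewrite !linearZ /= !mulrA.
by congr (_ * _); ring.
Qed.

Let tri1 (t : 2.-tuple 'I_n) : uniq t -> (tnth t (o2 0)) != (tnth t (o2 1)).
Proof. by move=> ut; exact: tnth_neq. Qed.

Lemma Ex_kernel1 s (t : 2.-tuple 'I_n) : uniq t -> Ex P (kernel1 s t) = \tr (TV m).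
Proof.
move=> ut; have g := gvec_Zplan s (tri1 ut).
rewrite ExZ; last exact: Zform_moments.
rewrite (Ex_bilin_gvec _ (posdef2V.1) g) tr_T2V.
by field.
Qed.

Lemma Ex_kernel1_sq s (t : 2.-tuple 'I_n) : uniq t ->
  Ex P (fun w => kernel1 s t w ^+ 2) <= 3 * \tr (TV m) ^+ 2.
Proof.
move=> ut; have g := gvec_Zplan s (tri1 ut).
under [X in Ex P X]eq_fun do rewrite exprMn.
rewrite ExZ; last exact/momentsX/Zform_moments.
have := Ex_quad2 posdef2V psd_projT g; rewrite tr_T2V /Zform.
set x := Ex P _; set y := \tr _; lra.
Qed.

Let pairs_disjoint (a b c d : 'I_n) : uniq [:: a; b; c; d] ->
  forall l, pred2 a b l -> ~~ pred2 c d l.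
Proof.
rewrite /= !inE !negb_or => /and4P[/and3P[_ ac ad] /andP[bc bd] _ _] l.
by move=> /pred2P[]->; rewrite negb_or; apply/andP; split.
Qed.

(** The constants are 9 * 4^2 and 225 * 4^3, the powers of 4 coming from the
    covariance 2 V_N in both arguments of the form. *)
Lemma Zform_cross (s : plan m) a b c d : uniq [:: a; b; c; d] ->
  [/\ Ex P (fun w => Zform s a b c d w ^+ 2) = 4 * tau 2,
      Ex P (fun w => Zform s a b c d w ^+ 4) <= 144 * tau 2 ^+ 2 &
      Ex P (fun w => Zform s a b c d w ^+ 6) <= 14400 * tau 2 ^+ 3].
Proof.
move=> u; have dj := pairs_disjoint u.
move: u; rewrite /= !inE !negb_or => /and4P[/and3P[ab _ _] _ cd _].
have g1 := gvec_Zplan s ab; have g2 := gvec_Zplan s cd.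
have ind := @Zplan_indep s _ _ dj.
have As := projT_sym m.
rewrite (Ex_cross2 posdef2V ind g1 g2 As) tr_T2V_sq; split => //.
  have := Ex_cross4 posdef2V ind g1 g2 As; rewrite tr_T2V_sq /Zform; lra.
have := Ex_cross6 posdef2V ind g1 g2 As; rewrite tr_T2V_sq /Zform; lra.
Qed.

Let sub4 k (t : k.-tuple 'I_n) (i1 i2 i3 i4 : 'I_k) : uniq t ->
  uniq [:: i1; i2; i3; i4] ->
  uniq [:: tnth t i1; tnth t i2; tnth t i3; tnth t i4].
Proof.
move=> /tuple_uniqP inj u; have := map_inj_uniq inj [:: i1; i2; i3; i4].
by rewrite u.
Qed.

Lemma Ex_kernel2 s (t : 4.-tuple 'I_n) : uniq t -> Ex P (kernel2 s t) = tau 2.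
Proof.
move=> ut; rewrite ExZ; last exact/momentsX/Zform_moments.
have [-> _ _] := Zform_cross s (@sub4 _ t (o4 0) (o4 1)
  (o4 2) (o4 3) ut isT).
by field.
Qed.

Lemma Ex_kernel2_sq s (t : 4.-tuple 'I_n) : uniq t ->
  Ex P (fun w => kernel2 s t w ^+ 2) <= 9 * tau 2 ^+ 2.
Proof.
move=> ut; under [X in Ex P X]eq_fun do rewrite exprMn -exprM.
rewrite ExZ; last exact/momentsX/Zform_moments.
have [_ + _] := Zform_cross s (@sub4 _ t (o4 0) (o4 1)
  (o4 2) (o4 3) ut isT).
set x := Ex P _; lra.
Qed.

Lemma Ex_kernel3 s (t : 6.-tuple 'I_n) : uniq t -> Ex P (kernel3 s t) = tau 3.
Proof.
move=> ut; rewrite ExZ; last first.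
  by apply: momentsM; [apply: momentsM|]; exact: Zform_moments.
have h01 : (tnth t (o6 0)) != (tnth t (o6 1)) by exact: tnth_neq.
have h23 : (tnth t (o6 2)) != (tnth t (o6 3)) by exact: tnth_neq.
have h45 : (tnth t (o6 4)) != (tnth t (o6 5)) by exact: tnth_neq.
have d23 := pairs_disjoint (@sub4 _ t (o6 2) (o6 3)
  (o6 4) (o6 5) ut isT).
have d02 := pairs_disjoint (@sub4 _ t (o6 0) (o6 1)
  (o6 2) (o6 3) ut isT).
have d04 := pairs_disjoint (@sub4 _ t (o6 0) (o6 1)
  (o6 4) (o6 5) ut isT).
(* Positions of the two pairs that are frozen while the first is integrated
   out. *)
pose L := predU (pred2 (tnth t (o6 2)) (tnth t (o6 3))) (pred2 (tnth t (o6 4)) (tnth t (o6 5))).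
have dL l : pred2 (tnth t (o6 0)) (tnth t (o6 1)) l -> ~~ L l.
  by move=> h; rewrite /L /= negb_or; apply/andP; split; [exact: d02|exact: d04].
have sub (L' : pred 'I_n) : (forall l, L' l -> L l) ->
    gen_of (@obsalg R m) (plan_block s L') `<=` <<s gen_of (@obsalg R m) (plan_block s L) >>.
  move=> LL X [ij Lij FX]; apply: sub_sigma_algebra; exists ij => //.
  exact: plan_blockS Lij.
have /= -> := Ex_cycle3 posdef2V.1 (projT_sym m) (@Zplan_indep s _ _ dL) (@Zplan_indep s _ _ d23)
  (sub _ _) (sub _ _) (gvec_Zplan s h01) (gvec_Zplan s h23) (gvec_Zplan s h45).
- by rewrite tr_T2V_cube; field.
- by move=> l h; rewrite /L /= h.
- by move=> l h; rewrite /L /=; apply/orP; right.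
Qed.

(** By [sqr_prod3_le] only the sixth moments of the three forms enter. *)
Lemma Ex_kernel3_sq s (t : 6.-tuple 'I_n) : uniq t ->
  Ex P (fun w => kernel3 s t w ^+ 2) <= 225 * tau 2 ^+ 3.
Proof.
move=> ut.
have [_ _ h1] := Zform_cross s (@sub4 _ t (o6 0) (o6 1)
  (o6 2) (o6 3) ut isT).
have [_ _ h2] := Zform_cross s (@sub4 _ t (o6 2) (o6 3)
  (o6 4) (o6 5) ut isT).
have [_ _ h3] := Zform_cross s (@sub4 _ t (o6 4) (o6 5)
  (o6 0) (o6 1) ut isT).
move: h1 h2 h3.
set x := Zform s (tnth t (o6 0)) (tnth t (o6 1)) (tnth t (o6 2)) (tnth t (o6 3)).
set y := Zform s (tnth t (o6 2)) (tnth t (o6 3)) (tnth t (o6 4)) (tnth t (o6 5)).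
set z := Zform s (tnth t (o6 4)) (tnth t (o6 5)) (tnth t (o6 0)) (tnth t (o6 1)).
move=> h1 h2 h3.
have Mx : moments P (fun w => x w ^+ 6) by exact/momentsX/Zform_moments.
have My : moments P (fun w => y w ^+ 6) by exact/momentsX/Zform_moments.
have Mz : moments P (fun w => z w ^+ 6) by exact/momentsX/Zform_moments.
have Ms := momentsD (momentsD Mx My) Mz.
have le w : kernel3 s t w ^+ 2 <= 192^-1 * (x w ^+ 6 + y w ^+ 6 + z w ^+ 6).
  exact: sqr_prod3_le.
apply: le_trans (le_Ex _ _ le) _.
- apply/momentsX/momentsZ.
  by apply: momentsM; [apply: momentsM|]; exact: Zform_moments.
- exact: momentsZ Ms.
rewrite (ExZ _ Ms) (ExD (momentsD Mx My) Mz) (ExD Mx My).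
move: (Ex P _) (Ex P _) (Ex P _) (tau 2 ^+ 3) h1 h2 h3 => a b c q h1 h2 h3.
lra.
Qed.

Lemma kernel1_moments s t : moments P (kernel1 s t).
Proof. by apply: momentsZ; exact: Zform_moments. Qed.

Lemma kernel2_moments s t : moments P (kernel2 s t).
Proof. by apply: momentsZ; apply: momentsX; exact: Zform_moments. Qed.

Lemma kernel3_moments s t : moments P (kernel3 s t).
Proof.
by apply: momentsZ; apply: momentsM; [apply: momentsM|]; exact: Zform_moments.
Qed.

Lemma kernel1_gmeas s (t : 2.-tuple 'I_n) : uniq t ->
  gmeas (gen_of (@obsalg R m) (plan_block s (mem t))) (kernel1 s t).
Proof.
by move=> ut; apply: gmeasM; [exact: gmeas_cst|exact: Zform_gmeas].
Qed.

Lemma kernel2_gmeas s (t : 4.-tuple 'I_n) : uniq t ->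
  gmeas (gen_of (@obsalg R m) (plan_block s (mem t))) (kernel2 s t).
Proof.
by move=> ut; apply: gmeasM; [exact: gmeas_cst|apply: gmeasX; exact: Zform_gmeas].
Qed.

Lemma kernel3_gmeas s (t : 6.-tuple 'I_n) : uniq t ->
  gmeas (gen_of (@obsalg R m) (plan_block s (mem t))) (kernel3 s t).
Proof.
move=> ut; apply: gmeasM; first exact: gmeas_cst.
by apply: gmeasM; [apply: gmeasM|]; exact: Zform_gmeas.
Qed.

(** Reduces each of the three estimators to the mean and the second moment of
    its kernel at fixed permutations. *)
Lemma ustat_shuffled k (h : plan m -> k.-tuple 'I_n -> Omega m -> R) theta K U :
  (0 < k)%N -> (k <= n)%N -> (0 < U)%N -> 0 <= K ->
  (forall s t, moments P (h s t)) ->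
  (forall s (t : k.-tuple 'I_n), uniq t ->
     gmeas (gen_of (@obsalg R m) (plan_block s (mem t))) (h s t)) ->
  (forall s (t : k.-tuple 'I_n), uniq t -> Ex P (h s t) = theta) ->
  (forall s (t : k.-tuple 'I_n), uniq t -> Ex P (fun w => h s t w ^+ 2) <= K) ->
  let B w := U%:R^-1 * \sum_(j < U) ustat (h (shufplan j w)) w in
  [/\ moments P B, Ex P B = theta &
      Ex P (fun w => (B w - theta) ^+ 2) <= ustat_factor R k * K / n%:R].
Proof.
move=> k0 kn U0 K0 Mh gh Eh Kh.
apply: (average_shuffled (S := fun s => ustat (h s)) U0).
- move=> s; apply: gmeasM; first exact: gmeas_cst.
  by apply: gmeas_sum => t ut; apply: gmeas_gen (gh s t ut).
- by move=> s; exact: ustat_moments.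
- by move=> s; apply: Ex_ustat => //; exact: Eh.
move=> s; apply: ustat_var => //; [exact: Eh|exact: Kh|].
move=> t t' ut ut' /hasPn dj.
have dj' l : mem t l -> ~~ mem t' l.
  by move=> lt; apply/negP => lt'; exact: (negP (dj l lt') lt).
exact: (Ex_indep (@Zplan_indep s _ _ dj') (gh s t ut) (gh s t' ut')
  (Mh s t) (Mh s t')).
Qed.

End kernels.

(** * The estimators as averages of U-statistics *)

Section symmetrization.
Context (R : realType).

(** Turns the sums over increasing pairs in B1 and B2 into sums over all
    ordered pairs, as the tuples of a U-statistic require. *)
Lemma sum_sym n (F : 'I_n -> 'I_n -> R) :
  (forall x y, F x y = F y x) -> (forall x, F x x = 0) ->
  \sum_x \sum_y F x y = 2 * \sum_(x < n) \sum_(y < n | (x < y)%N) F x y.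
Proof.
move=> Fs F0.
have E x : \sum_y F x y =
    \sum_(y < n | (x < y)%N) F x y + \sum_(y < n | (y < x)%N) F x y.
  rewrite (bigID (fun y : 'I_n => (x < y)%N)) /=; congr (_ + _).
  rewrite (bigD1 x) ?ltnn//= F0 add0r; apply: eq_bigl => y.
  by rewrite -leqNgt ltn_neqAle andbC.
rewrite (eq_bigr _ (fun x _ => E x)) big_split /= mulr2n mulrDl !mul1r.
congr (_ + _); under eq_bigr do rewrite big_mkcond.
rewrite exchange_big /=; apply: eq_bigr => y _.
by rewrite [RHS]big_mkcond; apply: eq_bigr => x _; rewrite Fs.
Qed.

Lemma sum_uniq2 n (G : 'I_n -> 'I_n -> R) :
  \sum_(t : 2.-tuple 'I_n | uniq t)
    G (tnth t (@Ordinal 2 0 isT)) (tnth t (@Ordinal 2 1 isT)) =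
  \sum_x \sum_y if uniq [:: x; y] then G x y else 0.
Proof.
rewrite big_mkcond.
by do 2!(rewrite big_tupleS; apply: eq_bigr => ? _); rewrite big_tuple0.
Qed.

Lemma sum_uniq4 n (G : 'I_n -> 'I_n -> 'I_n -> 'I_n -> R) :
  \sum_(t : 4.-tuple 'I_n | uniq t)
    G (tnth t (@Ordinal 4 0 isT)) (tnth t (@Ordinal 4 1 isT))
      (tnth t (@Ordinal 4 2 isT)) (tnth t (@Ordinal 4 3 isT)) =
  \sum_x \sum_y \sum_z \sum_u if uniq [:: x; y; z; u] then G x y z u else 0.
Proof.
rewrite big_mkcond.
by do 4!(rewrite big_tupleS; apply: eq_bigr => ? _); rewrite big_tuple0.
Qed.

Lemma sum_uniq6 n (G : 'I_n -> 'I_n -> 'I_n -> 'I_n -> 'I_n -> 'I_n -> R) :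
  \sum_(t : 6.-tuple 'I_n | uniq t)
    G (tnth t (@Ordinal 6 0 isT)) (tnth t (@Ordinal 6 1 isT))
      (tnth t (@Ordinal 6 2 isT)) (tnth t (@Ordinal 6 3 isT))
      (tnth t (@Ordinal 6 4 isT)) (tnth t (@Ordinal 6 5 isT)) =
  \sum_l1 \sum_l2 \sum_l3 \sum_l4 \sum_l5 \sum_(l6 | uniq [:: l1; l2; l3; l4; l5; l6])
    G l1 l2 l3 l4 l5 l6.
Proof.
rewrite big_mkcond.
do 5!(rewrite big_tupleS; apply: eq_bigr => ? _).
rewrite big_tupleS [RHS]big_mkcond; apply: eq_bigr => ? _.
by rewrite big_tuple0.
Qed.

End symmetrization.

Section estimators.
Context (R : realType) (m : model R).
Local Notation P := (prob m).
Local Notation n := (nmin m).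
Local Notation tau k := (\tr (TV m ^+ k)).

Lemma ZdiffE j l1 l2 w :
  @Zdiff R m j l1 l2 w = Zplan (shufplan j w) l1 l2 w.
Proof. by apply: eq_mxcol => i; rewrite /shuffled ffunE. Qed.

Lemma ZTZE j l1 l2 l3 l4 w :
  @ZTZ R m j l1 l2 l3 l4 w = Zform (shufplan j w) l1 l2 l3 l4 w.
Proof. by rewrite /ZTZ !ZdiffE. Qed.

Lemma Zplan_swap s l1 l2 w : @Zplan R m s l2 l1 w = - Zplan s l1 l2 w.
Proof. by apply/matrixP => i j; rewrite !mxE -mulrN opprB. Qed.

Lemma Zform_swapl s l1 l2 l3 l4 w :
  @Zform R m s l2 l1 l3 l4 w = - Zform s l1 l2 l3 l4 w.
Proof. by rewrite /Zform (Zplan_swap s l1 l2) -scaleN1r bilinZl mulN1r. Qed.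

Lemma Zform_swapr s l1 l2 l3 l4 w :
  @Zform R m s l1 l2 l4 l3 w = - Zform s l1 l2 l3 l4 w.
Proof. by rewrite /Zform (Zplan_swap s l3 l4) -scaleN1r bilinZr mulN1r. Qed.

Lemma B1E U w : (2 <= n)%N ->
  @B1 R m U w = U%:R^-1 * \sum_(j < U) ustat (kernel1 (shufplan j w)) w.
Proof.
move=> n2; have C0 : ('C(n, 2)%:R : R) != 0 by rewrite pnatr_eq0 -lt0n bin_gt0.
rewrite /B1 invfM [2^-1 * _]mulrC -mulrA mulr_sumr; congr (_ * _).
apply: eq_bigr => j _; rewrite /ustat /kernel1.
set s := shufplan j w.
rewrite (sum_uniq2 (fun x y => 2^-1 * Zform s x y x y w)) sum_sym; first last.
- by move=> x; rewrite /= inE eqxx.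
- move=> x y; rewrite /= !inE eq_sym.
  by rewrite (Zform_swapl s y x) (Zform_swapr s y x) opprK.
have -> : \sum_(x < n) \sum_(y < n | (x < y)%N)
    (if uniq [:: x; y] then 2^-1 * Zform s x y x y w else 0) =
    2^-1 * \sum_(x < n) \sum_(y < n | (x < y)%N) Zform s x y x y w.
  rewrite mulr_sumr; apply: eq_bigr => x _; rewrite mulr_sumr.
  apply: eq_bigr => y xy; rewrite /= inE andbT ifT//.
  by rewrite neq_ltn -?val_eqE /= xy.
rewrite -bin_ffact natrM.
under eq_bigr => x _ do (under eq_bigr => y _ do rewrite ZTZE -/s; rewrite -mulr_suml).
rewrite -mulr_suml (_ : 2`!%:R = 2)//.
by field.
Qed.

Lemma B2E U w : (4 <= n)%N ->
  @B2 R m U w = U%:R^-1 * \sum_(j < U) ustat (kernel2 (shufplan j w)) w.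
Proof.
move=> n4; have C0 : ('C(n, 4)%:R : R) != 0 by rewrite pnatr_eq0 -lt0n bin_gt0.
rewrite /B2 invfM [4^-1 * _]mulrC -mulrA mulr_sumr; congr (_ * _).
apply: eq_bigr => j _; rewrite /ustat /kernel2.
set s := shufplan j w.
rewrite (sum_uniq4 (fun x y z u => 4^-1 * Zform s x y z u w ^+ 2)).
pose F x y z u : R := if uniq [:: x; y; z; u] then 4^-1 * Zform s x y z u w ^+ 2 else 0.
rewrite -/(\sum_x \sum_y \sum_z \sum_u F x y z u).
have F12 x y z u : F x y z u = F y x z u.
  rewrite /F (uniq_catCA [:: x] [:: y] [:: z; u]) /=.
  by rewrite (Zform_swapl s y x) sqrrN.
have F34 x y z u : F x y z u = F x y u z.
  rewrite /F (_ : uniq [:: x; y; z; u] = uniq [:: x; y; u; z]).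
    by rewrite (Zform_swapr s _ _ u z) sqrrN.
  by apply: perm_uniq; rewrite !perm_cons (perm_catC [:: z] [:: u]).
have F0 x z u : F x x z u = 0 by rewrite /F /= !inE eqxx.
have F0' x y z : F x y z z = 0 by rewrite /F /= !inE eqxx !andbF.
rewrite [X in _ = _ * X](sum_sym (F := fun x y => \sum_z \sum_u F x y z u)); first last.
- by move=> x; apply: big1 => z _; apply: big1 => u _; exact: F0.
- by move=> x y; apply: eq_bigr => z _; apply: eq_bigr => u _; exact: F12.
have -> : \sum_(x < n) \sum_(y < n | (x < y)%N) \sum_z \sum_u F x y z u =
  2 * \sum_(x < n) \sum_(y < n | (x < y)%N) \sum_(z < n) \sum_(u < n | (z < u)%N) F x y z u.
  rewrite mulr_sumr; apply: eq_bigr => x _; rewrite mulr_sumr; apply: eq_bigr => y _.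
  by apply: sum_sym.
have -> : \sum_(x < n) \sum_(y < n | (x < y)%N) \sum_(z < n)
    \sum_(u < n | (z < u)%N) F x y z u =
  4^-1 * \sum_(x < n) \sum_(y < n) \sum_(z < n)
    \sum_(u < n | [&& uniq [:: x; y; z; u], (x < y)%N & (z < u)%N])
      Zform s x y z u w ^+ 2.
  rewrite mulr_sumr; apply: eq_bigr => x _; rewrite mulr_sumr big_mkcond.
  apply: eq_bigr => y _; case: ifP => xy; last first.
    rewrite big1 ?mulr0// => z _; apply: big_pred0 => u.
    by rewrite andbF.
  rewrite mulr_sumr; apply: eq_bigr => z _.
  rewrite mulr_sumr big_mkcond [RHS]big_mkcond; apply: eq_bigr => u _.
  by rewrite /F andTb; case: (uniq _); case: (z < u)%N.
rewrite -bin_ffact natrM natrM.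
under eq_bigr => x _ do (under eq_bigr => y _ do
  (under eq_bigr => z _ do (under eq_bigr => u _ do rewrite ZTZE -/s;
     rewrite -mulr_suml); rewrite -mulr_suml); rewrite -mulr_suml).
rewrite -mulr_suml (_ : 4`!%:R = 24) //.
by field.
Qed.

Lemma B3E U w : (6 <= n)%N ->
  @B3 R m U w = U%:R^-1 * \sum_(j < U) ustat (kernel3 (shufplan j w)) w.
Proof.
move=> n6.
rewrite /B3 invfM [8^-1 * _]mulrC -mulrA mulr_sumr; congr (_ * _).
apply: eq_bigr => j _; rewrite /ustat /kernel3.
set s := shufplan j w.
rewrite (sum_uniq6 (fun x y z u v t => 8^-1 * (Zform s x y z u w *
  Zform s z u v t w * Zform s v t x y w))).
(* The sum in B3 already runs over all ordered 6-tuples. *)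
have -> : n`!%:R / (n - 6)`!%:R = (n ^_ 6)%:R :> R.
  by rewrite -(ffact_fact n6) natrM mulfK// pnatr_eq0 -lt0n fact_gt0.
rewrite !mulr_sumr; do 5!(apply: eq_bigr => ? _; rewrite !mulr_sumr).
apply: eq_bigr => ? _; rewrite !ZTZE -/s.
by rewrite [LHS]mulrA [LHS]mulrC.
Qed.

Lemma B1_est U : (2 <= n)%N -> (0 < U)%N ->
  [/\ moments P (@B1 R m U), Ex P (@B1 R m U) = \tr (TV m) &
    Ex P (fun w => (@B1 R m U w - \tr (TV m)) ^+ 2) <=
      ustat_factor R 2 * (3 * \tr (TV m) ^+ 2) / n%:R].
Proof.
move=> n2 U0; rewrite (_ : @B1 R m U = fun w => U%:R^-1 *
    \sum_(j < U) ustat (kernel1 (shufplan j w)) w); last first.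
  by apply/funext => w; exact: B1E.
apply: ustat_shuffled => //.
- by rewrite mulr_ge0// sqr_ge0.
- exact: kernel1_moments.
- exact: kernel1_gmeas.
- exact: Ex_kernel1.
- exact: Ex_kernel1_sq.
Qed.

Lemma B2_est U : (4 <= n)%N -> (0 < U)%N ->
  [/\ moments P (@B2 R m U), Ex P (@B2 R m U) = tau 2 &
    Ex P (fun w => (@B2 R m U w - tau 2) ^+ 2) <=
      ustat_factor R 4 * (9 * tau 2 ^+ 2) / n%:R].
Proof.
move=> n4 U0; rewrite (_ : @B2 R m U = fun w => U%:R^-1 *
    \sum_(j < U) ustat (kernel2 (shufplan j w)) w); last first.
  by apply/funext => w; exact: B2E.
apply: ustat_shuffled => //.
- by rewrite mulr_ge0// sqr_ge0.
- exact: kernel2_moments.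
- exact: kernel2_gmeas.
- exact: Ex_kernel2.
- exact: Ex_kernel2_sq.
Qed.

(** T is a nonempty sum of outer products b b^T with b nonzero, and each
    contributes b^T V_N b > 0 to the trace. *)
Lemma tau1_gt0 : 0 < \tr (TV m).
Proof.
have [s s0 Es] := psd_sum_outer (psd_projT m).
rewrite /TV Es mxtrace_sum_outer.
have [_ V0] := posdef_VN m.
case: s s0 Es => [|b s] s0 Es.
  by have := projT_neq0 m; rewrite Es big_nil eqxx.
rewrite big_cons ltr_pwDl ?V0 ?s0 ?mem_head// big_seq sumr_ge0// => c cs.
by apply/ltW/V0/s0; rewrite inE cs orbT.
Qed.

(** As for [tau1_gt0] with TVT in place of T; TVT is nonzero because its
    trace is that of TV. *)
Lemma tau2_gt0 : 0 < tau 2.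
Proof.
have [Vs V0] := posdef_VN m.
pose M := projT m *m VN m *m projT m.
have pM : psd M.
  split; first by rewrite !trmx_mul projT_sym Vs mulmxA.
  move=> u; rewrite /M -{1}(projT_sym m) bilin_conj.
  have [->|/V0/ltW//] := eqVneq (projT m *m u) 0.
  by rewrite /bilin mulmx0 mxE.
have [s s0 Es] := psd_sum_outer pM.
have -> : tau 2 = \tr (M *m VN m).
  by rewrite expr2 -[TV m * TV m]/(TV m *m TV m) /TV /M !mulmxA.
rewrite Es mxtrace_sum_outer.
case: s s0 Es => [|b s] s0 Es.
  have := tau1_gt0; rewrite /TV -(projT_idem m) -mulmxA mxtrace_mulC -/M Es.
  by rewrite big_nil mxtrace0 ltxx.
rewrite big_cons ltr_pwDl ?V0 ?s0 ?mem_head// big_seq sumr_ge0// => c cs.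
by apply/ltW/V0/s0; rewrite inE cs orbT.
Qed.

Lemma B3_est U : (6 <= n)%N -> (0 < U)%N ->
  [/\ moments P (@B3 R m U), Ex P (@B3 R m U) = tau 3 &
    Ex P (fun w => (@B3 R m U w - tau 3) ^+ 2) <=
      ustat_factor R 6 * (225 * tau 2 ^+ 3) / n%:R].
Proof.
move=> n6 U0; rewrite (_ : @B3 R m U = fun w => U%:R^-1 *
    \sum_(j < U) ustat (kernel3 (shufplan j w)) w); last first.
  by apply/funext => w; exact: B3E.
apply: ustat_shuffled => //.
- by rewrite mulr_ge0// exprn_ge0// ltW// tau2_gt0.
- exact: kernel3_moments.
- exact: kernel3_gmeas.
- exact: Ex_kernel3.
- exact: Ex_kernel3_sq.
Qed.

End estimators.

(** * Stability and consistency *)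

Section conclusions.
Context (R : realType) (F : framework).

(** Each framework bounds nmin from below by a minimum that tends to infinity. *)
Lemma in_framework_nmin (m : nat -> model R) : in_framework F m ->
  forall N : nat, \forall k \near \oo, (N <= nmin (m k))%N.
Proof.
case: F => /=.
- move=> [_ /cvgnyPge h] N; move: (h N); apply: filterS => k.
  by rewrite leq_min => /andP[].
- move=> [_ /cvgnyPge h] N; move: (h N); apply: filterS => k.
  by rewrite leq_min => /andP[].
- move=> /cvgnyPge h N; move: (h N); apply: filterS => k.
  by rewrite !leq_min => /and3P[].
Qed.

(** C / nmin as a function of the sample sizes only, with the same start value
    as in [nmin]. *)
Definition rate (C : R) (a : nat) (nobs : 'I_a -> nat) : R :=
  C / (\big[minn/(\sum_(i < a) nobs i)%N]_(i < a) nobs i)%:R.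

Lemma rate_cvg0 C (m : nat -> model R) : 0 <= C -> in_framework F m ->
  rate C (@nobs R (m k)) @[k --> \oo] --> (0 : R).
Proof.
move=> C0 Fm; apply/cvgrPdist_le => e e0.
have := in_framework_nmin Fm (Num.truncn (C / e)).+1.
apply: filterS => k hk.
have nk0 : (0 : R) < (nmin (m k))%:R by rewrite ltr0n (leq_trans _ hk).
rewrite sub0r normrN /rate -/(ntot (m k)) -/(nmin (m k)) ger0_norm; last first.
  by rewrite divr_ge0.
rewrite ler_pdivrMr// mulrC -ler_pdivrMr//.
apply: (@le_trans _ _ (Num.truncn (C / e)).+1%:R); last by rewrite ler_nat.
by rewrite ltW// truncnS_gt.
Qed.

Section ratio.
Variables (est : estimator R) (theta : model R -> R) (s : nat) (C : R).
Hypothesis C0 : 0 <= C.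
Hypothesis theta0 : forall m, 0 < theta m.
Hypothesis estP : forall m, (s <= nmin m)%N ->
  [/\ moments (prob m) (@est m), Ex (prob m) (@est m) = theta m &
      Ex (prob m) (fun w => (@est m w - theta m) ^+ 2) <=
        C * theta m ^+ 2 / (nmin m)%:R].

Lemma est_unbiased : unbiased F s est theta.
Proof.
by move=> m _ k sk; have [M <- _] := estP sk; exact: Ex_EFin.
Qed.

Lemma ratio_moments m : (s <= nmin m)%N ->
  [/\ moments (prob m) (fun w => @est m w / theta m),
      Ex (prob m) (fun w => @est m w / theta m) = 1 &
      ('V_(prob m)[(fun w => @est m w / theta m)%R] <= (C / (nmin m)%:R)%:E)%E].
Proof.
move=> /estP[M E V].
have th := theta0 m.
have Er : (fun w => @est m w / theta m) = (fun w => (theta m)^-1 * @est m w).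
  by apply/funext => w; rewrite mulrC.
have E1 : Ex (prob m) (fun w => @est m w / theta m) = 1.
  by rewrite Er ExZ// E mulVf// gt_eqF.
have M1 : moments (prob m) (fun w => @est m w / theta m).
  by rewrite Er; exact: momentsZ.
split => //; rewrite Var_Ex// E1 lee_fin.
have -> : (fun w => (@est m w / theta m - 1) ^+ 2) =
    (fun w => (theta m ^+ 2)^-1 * (@est m w - theta m) ^+ 2).
  by apply/funext => w; field; rewrite gt_eqF.
rewrite ExZ; last by apply/momentsX/momentsB => //; exact: moments_cst.
by rewrite ler_pdivrMl ?exprn_gt0// mulrA [_ * C]mulrC.
Qed.

Lemma est_dim_stable : dim_stable F s (rate C) est theta.
Proof.
move=> m Fm; split; first exact: rate_cvg0.
move=> k sk; have [M E V] := ratio_moments sk; split; last exact: V.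
rewrite /= (Ex_EFin M) E subee// abse0 lee_fin.
by rewrite divr_ge0.
Qed.

Lemma est_consistent : ratio_consistent F est theta.
Proof.
move=> m Fm; split => // e e0.
apply: (@squeeze_cvge _ _ _ _ (cst 0%E) _
    (fun k => (e ^- 2 * rate C (@nobs R (m k)))%:E)).
- have := in_framework_nmin Fm s; apply: filterS => k sk.
  have [M E V] := ratio_moments sk.
  rewrite measure_ge0 /=.
  pose X : {mfun Omega (m k) >-> R} := mfun_Sub (mem_set (moments_meas M)).
  have := @chebyshev _ _ _ (prob (m k)) X e e0.
  rewrite (Ex_EFin M) E /= => h.
  apply: (@le_trans _ _ (prob (m k)
     [set w | e <= `|@est (m k) w / theta (m k) - 1|])).
    have mY : measurable_fun setT (fun w => `|@est (m k) w / theta (m k) - 1|).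
      apply: measurableT_comp => //.
      by apply: measurable_funB; [exact: (moments_meas M)|exact: measurable_cst].
    apply: le_measure; rewrite ?inE.
    + rewrite [X in measurable X](_ : _ =
        setT `&` (fun w => `|@est (m k) w / theta (m k) - 1|) @^-1` `]e, +oo[%classic).
        exact: mY.
      by rewrite setTI; apply/seteqP; split => w /=; rewrite in_itv/= andbT.
    + rewrite [X in measurable X](_ : _ =
        setT `&` (fun w => `|@est (m k) w / theta (m k) - 1|) @^-1` `[e, +oo[%classic).
        exact: mY.
      by rewrite setTI; apply/seteqP; split => w /=; rewrite in_itv/= andbT.
    + by move=> w /= /ltW.
  apply: (le_trans h); rewrite EFinM lee_pmul2l// lte_fin invr_gt0.
  by rewrite exprn_gt0.
- exact: cvg_cst.
- apply: cvg_EFin; first exact: nearW.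
  rewrite -(mulr0 (e ^- 2)).
  by apply: cvgM; [exact: cvg_cst|exact: rate_cvg0].
Qed.

End ratio.

End conclusions.

Theorem lemma6p2 (R : realType) (F : framework) :
  [/\ exists b : forall a : nat, ('I_a -> nat) -> R,
        forall U : nat, (0 < U)%N ->
          [/\ unbiased F 2 (fun m => @B1 R m U) (fun m => \tr (TV m)),
              dim_stable F 2 b (fun m => @B1 R m U) (fun m => \tr (TV m))
            & ratio_consistent F (fun m => @B1 R m U) (fun m => \tr (TV m))],
      exists b : forall a : nat, ('I_a -> nat) -> R,
        forall U : nat, (0 < U)%N ->
          [/\ unbiased F 4 (fun m => @B2 R m U)
                (fun m => \tr (TV m ^+ 2)),
              dim_stable F 4 b (fun m => @B2 R m U)
                (fun m => \tr (TV m ^+ 2))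
            & ratio_consistent F (fun m => @B2 R m U)
                (fun m => \tr (TV m ^+ 2))]
    & exists C : R,
        forall U : nat, (0 < U)%N ->
          unbiased F 6 (fun m => @B3 R m U) (fun m => \tr (TV m ^+ 3)) /\
          forall m : nat -> model R, in_framework F m ->
            \forall k \near \oo,
              ('V_(prob (m k))[@B3 R (m k) U] <=
                 (C * ((nmin (m k))%:R)^-1 * (\tr (TV (m k) ^+ 2)) ^+ 3)%:E)%E].
Proof.
split.
- have C0 : 0 <= ustat_factor R 2 * 3 by rewrite mulr_ge0.
  exists (rate (ustat_factor R 2 * 3)) => U U0.
  have estP (m : model R) : (2 <= nmin m)%N ->
    [/\ moments (prob m) (@B1 R m U), Ex (prob m) (@B1 R m U) = \tr (TV m) &
      Ex (prob m) (fun w => (@B1 R m U w - \tr (TV m)) ^+ 2) <=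
        ustat_factor R 2 * 3 * \tr (TV m) ^+ 2 / (nmin m)%:R].
    by move=> n2; have [? ? ?] := B1_est n2 U0; split => //; rewrite -(mulrA _ 3).
  split.
  + exact: (est_unbiased (est := fun m => @B1 R m U)
      (theta := fun m => \tr (TV m)) estP).
  + exact: (est_dim_stable (est := fun m => @B1 R m U)
      (theta := fun m => \tr (TV m)) C0 (@tau1_gt0 R) estP).
  + exact: (est_consistent (est := fun m => @B1 R m U)
      (theta := fun m => \tr (TV m)) C0 (@tau1_gt0 R) estP).
- have C0 : 0 <= ustat_factor R 4 * 9 by rewrite mulr_ge0.
  exists (rate (ustat_factor R 4 * 9)) => U U0.
  have estP (m : model R) : (4 <= nmin m)%N ->
    [/\ moments (prob m) (@B2 R m U), Ex (prob m) (@B2 R m U) = \tr (TV m ^+ 2) &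
      Ex (prob m) (fun w => (@B2 R m U w - \tr (TV m ^+ 2)) ^+ 2) <=
        ustat_factor R 4 * 9 * \tr (TV m ^+ 2) ^+ 2 / (nmin m)%:R].
    by move=> n4; have [? ? ?] := B2_est n4 U0; split => //; rewrite -(mulrA _ 9).
  split.
  + exact: (est_unbiased (est := fun m => @B2 R m U)
      (theta := fun m => \tr (TV m ^+ 2)) estP).
  + exact: (est_dim_stable (est := fun m => @B2 R m U)
      (theta := fun m => \tr (TV m ^+ 2)) C0 (@tau2_gt0 R) estP).
  + exact: (est_consistent (est := fun m => @B2 R m U)
      (theta := fun m => \tr (TV m ^+ 2)) C0 (@tau2_gt0 R) estP).
- exists (ustat_factor R 6 * 225) => U U0; split.
    by move=> m _ k n6; have [M <- _] := B3_est n6 U0; exact: Ex_EFin.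
  move=> m Fm; have := in_framework_nmin Fm 6; apply: filterS => k n6.
  have [M E V] := B3_est n6 U0.
  rewrite (Var_Ex M) E lee_fin; apply: le_trans V _.
  by rewrite mulrA mulrAC.
Qed.
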